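(* Let $a>0$, $\beta\in(1/2,1]$, and let $n=n_p$, $s=s_p$ satisfy $\log\log n\sim a\log p$ and $s\sim p^{1-\beta}$ as $p\to\infty$. Define $$r_2^*(a,\beta):=\begin{cases}\beta-1/2 & 1/2<\beta\le3/4,\\ (1-\sqrt{1-\beta})^2 & 3/4<\beta<1,\\ 1+a & \beta=1.\end{cases}$$ For $r>0$ put $\rho:=\sqrt{2r\log p}$. (1) (Lower bound) If $r<r_2^*(a,\beta)$, then $\mathcal R_{\mathrm{1-side}}(p,n,\rho,s)\not\to0$ as $p\to\infty$. (2) (Upper bound) If $r>r_2^*(a,\beta)$, then $\mathcal R_{\mathrm{1-side}}(p,n,\rho,s)\to0$ as $p\to\infty$.
   Context: Observation model: $X=\theta+E\in\mathbb R^{p\times n}$, $E$ with i.i.d. $N(0,1)$ entries. $\Theta_0(p,n)$: matrices whose rows are all constant. $\Theta_1^{\mathrm{1-side}}(p,n,\rho,s)$: matrices $\theta$ for which there exist $t^*\in[n-1]$, reals $\mu_{j1},\mu_{j2}$ and $S\subseteq[p]$ with $|S|\ge s$ such that $\theta_{ji}=\mu_{j1}$ for $i\le t^*$, $\theta_{ji}=\mu_{j2}$ for $i>t^*$, and $\sqrt{t^*(n-t^* )/n}(\mu_{j1}-\mu_{j2})\ge\rho$ for all $j\in S$. $\mathcal R_{\mathrm{1-side}}(p,n,\rho,s)=\inf_\psi[\sup_{\Theta_0}\mathbb E_\theta\psi+\sup_{\Theta_1^{\mathrm{1-side}}(p,n,\rho,s)}\mathbb E_\theta(1-\psi)]$ over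 measurable tests $\psi:\mathbb R^{p\times n}\to\{0,1\}$. $a_p\sim b_p$ means $a_p/b_p\to1$. *)

(* Defs.v *)
From HB Require Import structures.
From mathcomp Require Import all_boot all_order all_algebra.
From mathcomp Require Import all_classical all_reals all_analysis.
Set Implicit Arguments. Unset Strict Implicit. Unset Printing Implicit Defensive.
Import Order.TTheory GRing.Theory Num.Theory.
Import numFieldNormedType.Exports.
Local Open Scope classical_set_scope.
Local Open Scope ring_scope.

Section Model.
Variable R : realType.

(* Borel sigma-algebra on R^{p x n}: generated by the coordinate maps. *)
Definition coord_gen (p n : nat) : set (set 'M[R]_(p, n)) :=
  [set A | exists (j : 'I_p) (i : 'I_n) (B : set R),
      measurable B /\ A = (fun X : 'M[R]_(p, n) => X j i) @^-1` B].

Definition measurable_test (p n : nat) (psi : 'M[R]_(p, n) -> bool) : Prop :=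
  <<s @coord_gen p n >> (psi @^-1` [set true]).

Definition mx_set (p n : nat) (X : 'M[R]_(p, n)) (j : 'I_p) (i : 'I_n) (y : R)
  : 'M[R]_(p, n) :=
  \matrix_(k, l) if (k == j) && (l == i) then y else X k l.

Fixpoint gauss_iint (p n : nat) (theta : 'M[R]_(p, n))
  (idx : seq ('I_p * 'I_n)) (f : 'M[R]_(p, n) -> \bar R) (X : 'M[R]_(p, n))
  : \bar R :=
  match idx with
  | [::] => f X
  | ji :: idx' =>
      (\int[normal_prob (theta ji.1 ji.2) 1]_y
         gauss_iint theta idx' f (mx_set X ji.1 ji.2 y))%E
  end.

(* E_theta f(X) for X = theta + E, E with iid N(0,1) entries
   (Tonelli: for measurable f >= 0 this is the integral against the
   product Gaussian measure N(theta, I) on R^{p x n}). *)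
Definition Etheta (p n : nat) (theta : 'M[R]_(p, n)) (f : 'M[R]_(p, n) -> \bar R)
  : \bar R :=
  gauss_iint theta (enum [set: 'I_p * 'I_n]) f 0.

Definition Theta0 (p n : nat) : set 'M[R]_(p, n) :=
  [set theta | forall (j : 'I_p) (i i' : 'I_n), theta j i = theta j i'].

(* Theta_1^{1-side}(p,n,rho,s).  Columns are 0-indexed, so "i <= t*"
   (1-indexed) becomes (i : nat) < t*. *)
Definition Theta1_1side (p n : nat) (rho : R) (s : nat) : set 'M[R]_(p, n) :=
  [set theta | exists (t : nat) (mu1 mu2 : 'I_p -> R) (S : {set 'I_p}),
     [/\ (1 <= t)%N, (t <= n - 1)%N, (s <= #|S|)%N,
         (forall (j : 'I_p) (i : 'I_n),
             theta j i = if (i < t)%N then mu1 j else mu2 j) &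
         (forall j, j \in S ->
             Num.sqrt ((t * (n - t))%:R / n%:R) * (mu1 j - mu2 j) >= rho)]].

Definition risk_1side (p n : nat) (rho : R) (s : nat) : \bar R :=
  ereal_inf [set r | exists psi : 'M[R]_(p, n) -> bool,
    measurable_test psi /\
    r = (ereal_sup [set Etheta theta (fun X => (psi X)%:R%:E) | theta in @Theta0 p n]
       + ereal_sup [set Etheta theta (fun X => (~~ psi X)%:R%:E)
                   | theta in @Theta1_1side p n rho s])%E].

Definition r2star (a beta : R) : R :=
  if beta <= 3 / 4 then beta - 1 / 2
  else if beta < 1 then (1 - Num.sqrt (1 - beta)) ^+ 2
  else 1 + a.

End Model.

(* Main.v *)
(** Lower bound.  The risk is at least [E_0 min(1, L)] for the likelihood ratio
    [L] of any prior on the alternative.  Rows are cut into [s] blocks and each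
    block carries one signal, uniform over its [N] atoms, so that [L] is a product
    of block averages [S].  Instead of a truncated second moment, the fractional
    moment [E L^(1+u)] with [0 < u <= 1] is bounded: writing
    [E S^(1+u) = mean_k E_k S^u], subadditivity of [x^u] isolates the atom [k] and
    [x^u <= 1 - u + u x] handles the others, which gives
    [N^(-u) exp(V u(1+u)/2) + 1 - u + u exp(eta)], where [V] bounds the squared
    norms and [eta] the correlations of the atoms.  Optimizing [u] gives the sharp
    constant: [u = 1] for [beta <= 3/4], [u = c/(1-c)] with [c = sqrt(1-beta)] for
    [3/4 < beta < 1], and [u -> 0] for [beta = 1], where the atoms also run over
    about [log n / log p] change points [p^(2k)] that are nearly orthogonal.

    Upper bound.  Change points are discretized by a dyadic grid of [O(log n)]
    points.  For [beta < 1] the test counts, at each grid point, the rows whose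
    CUSUM statistic exceeds [tau] in absolute value; the count is centred at its
    null mean, and a Chernoff bound on both sides beats the union bound over the
    grid.  Two-sided exceedances are needed since the rows outside the signal set
    are arbitrary: a shift can only increase [P(|Z| > tau)].  For [beta = 1] the
    maximum of the CUSUM statistics is used. *)
Require Import Defs.
From HB Require Import structures.
From mathcomp Require Import all_boot all_order all_algebra.
From mathcomp Require Import all_classical all_reals all_analysis.
From mathcomp Require Import measurable_realfun.
From mathcomp Require Import ring lra zify.
Set Implicit Arguments. Unset Strict Implicit. Unset Printing Implicit Defensive.
Import Order.TTheory GRing.Theory Num.Theory.
Import numFieldNormedType.Exports.
Local Open Scope classical_set_scope.
Local Open Scope ring_scope.

(** * One-dimensional normal integrals *)

(** With [u = 1] the atom term of the moment bound is N^(-1) exp(V). Raised to s blocks it is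
    bounded only for r <= beta - 1/2, which lies below the boundary once beta > 3/4. A smaller [u]
    damps the rare large values of the likelihood ratio, the task usually given to truncation. The
    parameter a matters only at beta = 1. For beta < 1 the count test errs with probability about
    exp(-p^h), which absorbs the polynomially many grid points, and a single change point suffices
    for the lower bound. At beta = 1 a row errs with polynomially small probability, and the grid
    costs a factor p^a. In the upper bound the threshold and the signal are [k] and [g] times sqrt(2
    log p). Counting works when 2(1 - beta - (k-g)^2) > 1 - k^2: the squared gain s^2 p^(-2(k-g)^2)
    in the mean must beat the null mean p^(1-k^2), which controls the variance. The best choice is k
    = 2g while 2g < 1, and k near 1 otherwise; this produces the split at beta = 3/4. *)

Section normal1.
Context {R : realType}.
Local Notation mu := (@lebesgue_measure R).
Implicit Types (m x : R) (f : R -> \bar R).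

(** The Radon-Nikodym derivative and [normal_pdf] have the same integral over every measurable set,
    hence agree almost everywhere. *)
Lemma normal_prob_density m f : measurable_fun [set: R] f -> (forall x, 0 <= f x)%E ->
  (\int[normal_prob m 1]_x f x = \int[mu]_x (f x * (normal_pdf m 1 x)%:E))%E.
Proof.
move=> mf f0.
have dom := @normal_prob_dominates R m 1.
rewrite -(Radon_Nikodym_SigmaFinite.change_of_variables dom)//.
apply: ae_eq_integral => //.
- apply: emeasurable_funM => //.
  exact: measurable_int (Radon_Nikodym_SigmaFinite.f_integrable dom).
- apply: emeasurable_funM => //.
  by apply/measurable_EFinP; exact: measurable_normal_pdf.
- apply: ae_eqe_mul2l.
  apply: integral_ae_eq => //.
  + exact: Radon_Nikodym_SigmaFinite.f_integrable.
  + by apply/measurable_EFinP; exact: measurable_normal_pdf.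
  + by move=> A _ mA; rewrite -Radon_Nikodym_SigmaFinite.f_integral.
Qed.

Lemma normal_prob_tilt m f : measurable_fun [set: R] f -> (forall x, 0 <= f x)%E ->
  (\int[normal_prob m 1]_x f x =
   \int[normal_prob 0 1]_x (f x * (expR (m * x - m ^+ 2 / 2))%:E))%E.
Proof.
move=> mf f0; rewrite (normal_prob_density m)//.
rewrite (@normal_prob_density 0 (fun x => f x * _)%E); last 2 first.
- apply: emeasurable_funM => //; apply/measurable_EFinP.
  by apply: measurableT_comp => //; apply: measurable_funB => //; exact: measurable_funM.
- by move=> x; rewrite mule_ge0// lee_fin expR_ge0.
apply: eq_integral => x _; rewrite -muleA -EFinM; congr (_ * _%:E)%E.
rewrite !normal_pdfE ?oner_neq0// /normal_fun mulrCA -expRD; congr (_ * expR _).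
by rewrite expr1n; field.
Qed.

(** Lebesgue measure is determined by its values on half-open intervals, whose length a translation
    preserves. *)
Lemma lebesgue_measure_shift m (A : set R) : measurable A ->
  pushforward mu (fun x : measurableTypeR R => (x + m : measurableTypeR R)) A = mu A.
Proof.
have mphi : measurable_fun setT (fun x : measurableTypeR R => x + m : measurableTypeR R).
  exact: measurable_funD.
pose phi : {mfun measurableTypeR R >-> measurableTypeR R} :=
  HB.pack (fun x : measurableTypeR R => x + m : measurableTypeR R)
    (isMeasurableFun.Build _ _ _ _ _ mphi).
move=> mA.
suff -> : mu A = pushforward mu phi A by [].
apply: lebesgue_measure_unique => // _ [[a b]] _ <-.
rewrite /= /pushforward (_ : _ @^-1` _ = `]a - m, b - m]%classic).
  rewrite !lebesgue_measure_itv/= !lte_fin ltrD2r; case: ifP => // _.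
  by rewrite -!EFinB; congr EFin; ring.
apply/seteqP; split=> x /=; rewrite !in_itv/= => /andP[? ?].
  by apply/andP; split; lra.
by apply/andP; split; lra.
Qed.

Lemma normal_prob_shift m f : measurable_fun [set: R] f -> (forall x, 0 <= f x)%E ->
  (\int[normal_prob m 1]_x f x = \int[normal_prob 0 1]_x (f (x + m)%R))%E.
Proof.
move=> mf f0.
pose phi (x : measurableTypeR R) : measurableTypeR R := x + m.
have mphi : measurable_fun setT phi by exact: measurable_funD.
rewrite (normal_prob_density m)//.
apply: etrans (esym (@normal_prob_density 0 (f \o phi) (measurableT_comp mf mphi)
  (fun x => f0 (phi x)))).
pose g (x : R) := (f x * (normal_pdf m 1 x)%:E)%E.
transitivity (\int[mu]_x ((g \o phi) x))%E; last first.
  apply: eq_integral => x _ /=; congr (_ * _%:E)%E.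
  by rewrite !normal_pdfE ?oner_neq0// /normal_fun addrK subr0.
have mg : measurable_fun [set: R] g.
  by apply: emeasurable_funM => //; apply/measurable_EFinP; exact: measurable_normal_pdf.
rewrite -(preimage_setT phi) -ge0_integral_pushforward//.
  by apply: eq_measure_integral => //= A mA _; rewrite lebesgue_measure_shift.
by move=> y _; rewrite mule_ge0// lee_fin normal_pdf_ge0.
Qed.

Lemma normal_prob_opp f : measurable_fun [set: R] f -> (forall x, 0 <= f x)%E ->
  (\int[normal_prob 0 1]_x f x = \int[normal_prob 0 1]_x (f (- x)%R))%E.
Proof.
move=> mf f0.
pose phi (x : measurableTypeR R) : measurableTypeR R := - x.
have mphi : measurable_fun setT phi by exact: oppr_measurable.
rewrite (@normal_prob_density 0 f)//.
apply: etrans (esym (@normal_prob_density 0 (f \o phi) (measurableT_comp mf mphi)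
  (fun x => f0 (phi x)))).
pose g (x : R) := (f x * (normal_pdf 0 1 x)%:E)%E.
transitivity (\int[mu]_x ((g \o phi) x))%E; last first.
  apply: eq_integral => x _ /=; congr (_ * _%:E)%E.
  by rewrite !normal_pdfE ?oner_neq0// /normal_fun !subr0 sqrrN.
have mg : measurable_fun [set: R] g.
  by apply: emeasurable_funM => //; apply/measurable_EFinP; exact: measurable_normal_pdf.
rewrite -(preimage_setT phi) -ge0_integral_pushforward//.
  by apply: eq_measure_integral => //= A mA _; rewrite lebesgue_measureN.
by move=> y _; rewrite mule_ge0// lee_fin normal_pdf_ge0.
Qed.

Lemma normal_prob_cst m (c : \bar R) : (\int[normal_prob m 1]_x c = c)%E.
Proof. by rewrite integral_cst//= probability_setT mule1. Qed.

End normal1.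

(** * Expectations over Gaussian matrices *)

Section iterated_gaussian.
Context {R : realType} {p n : nat}.
Local Notation M := 'M[R]_(p, n).
Implicit Types (th X Y : M) (idx : seq ('I_p * 'I_n)) (P : pred ('I_p * 'I_n)).

(* Matrices with the sigma-algebra for which [measurable_test] is measurability. *)
Definition obs := g_sigma_algebraType (@coord_gen R p n).

Definition nnmeas (f : M -> \bar R) :=
  measurable_fun [set: obs] (f : obs -> \bar R) /\ (forall X, 0 <= f X)%E.

(** Replaces independence: under a product law, functions of disjoint sets of entries are
    independent. *)
Definition depends_on {T} (P : pred ('I_p * 'I_n)) (f : M -> T) :=
  forall X Y, (forall j i, P (j, i) -> X j i = Y j i) -> f X = f Y.

Lemma measurable_coord j i : measurable_fun [set: obs] (fun X : obs => (X : M) j i).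
Proof.
by move=> _ B mB; rewrite setTI; apply: sub_sigma_algebra; exists j, i, B.
Qed.

(** Joint measurability in the matrix and the new entry is what Tonelli's theorem asks of the inner
    integrals. *)
Lemma measurable_mx_set j i :
  measurable_fun [set: (obs * R)%type] (fun z : obs * R => mx_set (z.1 : M) j i z.2 : obs).
Proof.
apply: (@measurability _ _ _ obs _ _ (@coord_gen R p n)) => //.
move=> _ [_ [k [l [B [mB ->]]]] <-]; rewrite setTI.
have [/eqP e|e] := boolP ((k, l) == (j, i)).
  case: e => -> ->.
  rewrite (_ : _ @^-1` _ = (@snd obs R) @^-1` B).
    by rewrite -[X in measurable X]setTI; exact: measurable_snd.
  by apply/seteqP; split=> z /=; rewrite mxE !eqxx.
rewrite (_ : _ @^-1` _ = (@fst obs R) @^-1` ((fun X : obs => (X : M) k l) @^-1` B)).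
  rewrite -[X in measurable X]setTI; apply: measurable_fst => //.
  by rewrite -[X in measurable X]setTI; exact: measurable_coord.
by apply/seteqP; split=> z /=; rewrite mxE; rewrite xpair_eqE in e; rewrite (negbTE e).
Qed.

Lemma measurable_mx_set2 X j i :
  measurable_fun [set: R] (fun y : R => mx_set X j i y : obs).
Proof. exact: (measurable_fun_pair2 (X : obs) (measurable_mx_set j i)). Qed.

Lemma nnmeas_set (f : M -> \bar R) X j i : nnmeas f ->
  measurable_fun [set: R] (fun y => f (mx_set X j i y)).
Proof. by case=> mf _; exact: (measurableT_comp mf (measurable_mx_set2 X j i)). Qed.

(** The invariant behind the later inductions on [idx]: every partial integral is again a legitimate
    integrand. *)
Lemma gauss_iint_nnmeas th idx f : nnmeas f -> nnmeas (gauss_iint th idx f).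
Proof.
move=> nf; elim: idx => [//|[j i] idx [mF F0]] /=; split; last first.
  by move=> X; apply: integral_ge0 => y _.
have mh : measurable_fun [set: (obs * R)%type]
    (fun z : obs * R => gauss_iint th idx f (mx_set (z.1 : M) j i z.2)).
  exact: (measurableT_comp mF (measurable_mx_set j i)).
exact: (@measurable_fun_fubini_tonelli_F _ _ obs _ R (normal_prob (th j i) 1) _ mh
  (fun _ => F0 _)).
Qed.

Lemma mx_set_id X j i y : mx_set X j i y j i = y.
Proof. by rewrite mxE !eqxx. Qed.

Lemma mx_set_neq X j i y k l : (k, l) != (j, i) -> mx_set X j i y k l = X k l.
Proof. by rewrite xpair_eqE => e; rewrite mxE (negbTE e). Qed.

Lemma gauss_iint_eq th idx (f g : M -> \bar R) : f =1 g ->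
  gauss_iint th idx f =1 gauss_iint th idx g.
Proof. by move=> fg X; congr (gauss_iint th idx _ X); apply/funext. Qed.

Lemma gauss_iint_cst th idx (c : \bar R) X : gauss_iint th idx (fun=> c) X = c.
Proof.
elim: idx X => [//|[j i] idx IH] X /=.
by under eq_integral do rewrite IH; rewrite normal_prob_cst.
Qed.

Lemma gauss_iintD th idx f g X : nnmeas f -> nnmeas g ->
  (gauss_iint th idx (fun X => f X + g X) X =
   gauss_iint th idx f X + gauss_iint th idx g X)%E.
Proof.
move=> nf ng; elim: idx X => [//|[j i] idx IH] X /=.
under eq_integral do rewrite IH.
have nF := gauss_iint_nnmeas th idx nf; have nG := gauss_iint_nnmeas th idx ng.
rewrite ge0_integralD//=; last exact: nnmeas_set.
- by move=> y _; case: nF.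
- exact: nnmeas_set.
- by move=> y _; case: nG.
Qed.

Lemma gauss_iintZ th idx f (k : \bar R) X : nnmeas f -> (0 <= k)%E ->
  (gauss_iint th idx (fun X => k * f X) X = k * gauss_iint th idx f X)%E.
Proof.
move=> nf k0; elim: idx X => [//|[j i] idx IH] X /=.
under eq_integral do rewrite IH.
have nF := gauss_iint_nnmeas th idx nf.
rewrite ge0_integralZl//=; first exact: nnmeas_set.
by move=> y _; case: nF.
Qed.

Lemma gauss_iint_le th idx f g X : nnmeas f -> nnmeas g -> (forall X, f X <= g X)%E ->
  (gauss_iint th idx f X <= gauss_iint th idx g X)%E.
Proof.
move=> nf ng fg; elim: idx X => [//|[j i] idx IH] X /=.
have nF := gauss_iint_nnmeas th idx nf; have nG := gauss_iint_nnmeas th idx ng.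
apply: ge0_le_integral => //=.
- by move=> y _; case: nF.
- exact: nnmeas_set.
- exact: nnmeas_set.
Qed.

(** Integrating an entry overwrites it, so its initial value is forgotten. *)
Lemma gauss_iint_depends th idx (f : M -> \bar R) P : depends_on P f ->
  depends_on (fun a => P a && (a \notin idx)) (gauss_iint th idx f).
Proof.
move=> df; elim: idx => [|[j i] idx IH] X Y XY /=.
  by apply: df => j i Pji; apply: XY; rewrite Pji.
apply: eq_integral => y _; apply: IH => k l /andP[Pkl kl].
have [[-> ->]|e] := eqVneq (k, l) (j, i); first by rewrite !mx_set_id.
by rewrite !mx_set_neq//; apply: XY; rewrite Pkl inE negb_or e.
Qed.

Lemma nnmeasM f g : nnmeas f -> nnmeas g -> nnmeas (fun X => f X * g X)%E.
Proof.
move=> [mf f0] [mg g0]; split; first exact: emeasurable_funM.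
by move=> X; rewrite mule_ge0.
Qed.

Lemma gauss_iint_pull th idx f (g : M -> \bar R) P X : nnmeas f ->
  (forall X, 0 <= g X)%E -> depends_on P g -> (forall a, P a -> a \notin idx) ->
  (gauss_iint th idx (fun X => g X * f X) X = g X * gauss_iint th idx f X)%E.
Proof.
move=> nf g0 dg; elim: idx X => [//|[j i] idx IH] X Pidx /=.
have nF := gauss_iint_nnmeas th idx nf.
rewrite -ge0_integralZl//=; last 2 first.
- exact: nnmeas_set.
- by move=> y _; case: nF.
apply: eq_integral => y _; rewrite IH.
  congr (_ * _)%E; apply: dg => k l Pkl; rewrite mx_set_neq//.
  by move: (Pidx _ Pkl); rewrite inE negb_or => /andP[].
by move=> a /Pidx; rewrite inE negb_or => /andP[].
Qed.

(** At each entry one of the two factors is blind to it and leaves the integral as a constant, while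
    the mean of that factor is unchanged by the extra integration. *)
Lemma gauss_iint_indep th idx f g P X : nnmeas f -> nnmeas g ->
  depends_on P f -> depends_on (fun a => ~~ P a) g ->
  (gauss_iint th idx (fun X => f X * g X) X =
   gauss_iint th idx f X * gauss_iint th idx g X)%E.
Proof.
move=> nf ng df dg; elim: idx X => [//|[j i] idx IH] X /=.
under eq_integral do rewrite IH.
have nF := gauss_iint_nnmeas th idx nf; have nG := gauss_iint_nnmeas th idx ng.
have [Pji|Pji] := boolP (P (j, i)).
  have eG y : gauss_iint th idx g (mx_set X j i y) = gauss_iint th idx g X.
    apply: (@gauss_iint_depends th idx g _ dg) => k l /andP[Pkl _]; rewrite mx_set_neq//.
    by apply: contraNneq Pkl => ->.
  under [in LHS]eq_integral do rewrite eG.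
  under [X in (_ = _ * X)%E]eq_integral do rewrite eG.
  rewrite normal_prob_cst ge0_integralZr//=; first exact: nnmeas_set.
  - by move=> y _; case: nF.
  - by case: nG.
have eF y : gauss_iint th idx f (mx_set X j i y) = gauss_iint th idx f X.
  apply: (@gauss_iint_depends th idx f _ df) => k l /andP[Pkl _]; rewrite mx_set_neq//.
  by apply: contraNneq Pji => <-.
under [in LHS]eq_integral do rewrite eF.
under [X in (_ = X * _)%E]eq_integral do rewrite eF.
rewrite normal_prob_cst ge0_integralZl//=; first exact: nnmeas_set.
- by move=> y _; case: nG.
- by case: nF.
Qed.

(** The starting matrix is mapped as well, so that the induction hypothesis applies after one entry
    has been overwritten. *)
Lemma gauss_iint_map th (phi : 'I_p -> 'I_n -> R -> R) idx f X : nnmeas f ->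
  (forall j i h, measurable_fun [set: R] h -> (forall y, 0 <= h y)%E ->
     (\int[normal_prob (th j i) 1]_y h y = \int[normal_prob 0 1]_y h (phi j i y))%E) ->
  gauss_iint th idx f (\matrix_(j, i) phi j i (X j i)) =
  gauss_iint 0 idx (fun X => f (\matrix_(j, i) phi j i (X j i))) X.
Proof.
move=> nf hphi; elim: idx X => [//|[j i] idx IH] X /=.
have nF := gauss_iint_nnmeas th idx nf.
rewrite hphi; last 2 first.
- exact: nnmeas_set.
- by move=> y; case: nF.
rewrite mxE; apply: eq_integral => y _; rewrite -IH; congr gauss_iint.
apply/matrixP => k l; rewrite !mxE.
by case: ifP => // /andP[/eqP -> /eqP ->].
Qed.

(** Restricted to the entries of [idx], so that the tilting induction can add one factor at a time;
    over all entries it is [lr]. *)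
Definition lik idx th X := expR (\sum_(a <- idx) (th a.1 a.2 * X a.1 a.2 - th a.1 a.2 ^+ 2 / 2)).

Lemma lik_nnmeas idx th : nnmeas (fun X => (lik idx th X)%:E).
Proof.
split=> [|X]; last by rewrite lee_fin expR_ge0.
apply/measurable_EFinP; apply: measurableT_comp => //.
apply: measurable_sum => a; apply: measurable_funB => //.
by apply: measurable_funM => //; exact: measurable_coord.
Qed.

Lemma gauss_iint_tilt th idx f X : uniq idx -> nnmeas f ->
  (gauss_iint th idx f X = gauss_iint 0 idx (fun X => (lik idx th X)%:E * f X) X)%E.
Proof.
move=> + nf; elim: idx X => [|[j i] idx IH] X /=.
  by rewrite /lik big_nil expR0 mul1e.
move=> /andP[ji uidx].
have nF := gauss_iint_nnmeas th idx nf.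
rewrite normal_prob_tilt; last 2 first.
- exact: nnmeas_set.
- by move=> y; case: nF.
rewrite mxE; apply: eq_integral => y _; rewrite IH// muleC.
(* The new factor involves only entry (j, i), absent from [idx] by uniqueness, and so moves inside
   the remaining integrals. *)
pose g X := (expR (th j i * X j i - th j i ^+ 2 / 2))%:E.
have -> : (expR (th j i * y - th j i ^+ 2 / 2))%:E = g (mx_set X j i y).
  by rewrite /g mx_set_id.
rewrite -(@gauss_iint_pull 0 idx _ g (pred1 (j, i))).
- by apply: gauss_iint_eq => Y; rewrite muleA -EFinM -expRD /lik big_cons.
- exact/nnmeasM/nf/lik_nnmeas.
- by move=> Y; rewrite lee_fin expR_ge0.
- by move=> Y Z YZ; rewrite /g YZ//=.
- by move=> a /= /eqP ->.
Qed.

End iterated_gaussian.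

(** * Expectations of real functions: linearity, independence, tilting, shifting *)

Section gaussian_expectation.
Context {R : realType} {p n : nat}.
Local Notation M := 'M[R]_(p, n).
Implicit Types (th v X Y : M) (f g : M -> R).

Definition nnmeasR f :=
  measurable_fun [set: @obs R p n] (f : @obs R p n -> R) /\ forall X, 0 <= f X.

Definition esp th f : \bar R := Etheta th (fun X => (f X)%:E).

Definition dot v X := \sum_(a : 'I_p * 'I_n) v a.1 a.2 * X a.1 a.2.

(* Likelihood ratio of [N(v, I)] with respect to [N(0, I)]. *)
Definition lr v X := expR (dot v X - dot v v / 2).

Lemma nnmeas_EFin f : nnmeasR f -> nnmeas (fun X => (f X)%:E).
Proof. by case=> mf f0; split=> [|X]; [exact/measurable_EFinP|rewrite lee_fin]. Qed.

Lemma nnmeasR_cst c : 0 <= c -> nnmeasR (fun=> c).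
Proof. by move=> c0; split=> //; exact: measurable_cst. Qed.

Lemma nnmeasR_add f g : nnmeasR f -> nnmeasR g -> nnmeasR (fun X => f X + g X).
Proof. by move=> [mf f0] [mg g0]; split=> [|X]; [exact: measurable_funD|rewrite addr_ge0]. Qed.

Lemma nnmeasR_mul f g : nnmeasR f -> nnmeasR g -> nnmeasR (fun X => f X * g X).
Proof. by move=> [mf f0] [mg g0]; split=> [|X]; [exact: measurable_funM|rewrite mulr_ge0]. Qed.

Lemma nnmeasR_sum (I : eqType) (r : seq I) (F : I -> M -> R) :
  (forall i, i \in r -> nnmeasR (F i)) -> nnmeasR (fun X => \sum_(i <- r) F i X).
Proof.
elim: r => [|i r IH] hF.
  by under eq_fun do rewrite big_nil; exact: nnmeasR_cst.
under eq_fun do rewrite big_cons; apply: nnmeasR_add; first exact/hF/mem_head.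
by apply: IH => k kr; apply: hF; rewrite inE kr orbT.
Qed.

Lemma nnmeasR_prod (I : eqType) (r : seq I) (F : I -> M -> R) :
  (forall i, i \in r -> nnmeasR (F i)) -> nnmeasR (fun X => \prod_(i <- r) F i X).
Proof.
elim: r => [|i r IH] hF.
  by under eq_fun do rewrite big_nil; exact: nnmeasR_cst.
under eq_fun do rewrite big_cons; apply: nnmeasR_mul; first exact/hF/mem_head.
by apply: IH => k kr; apply: hF; rewrite inE kr orbT.
Qed.

Lemma measurable_dot v : measurable_fun [set: @obs R p n] (dot v : @obs R p n -> R).
Proof.
apply: measurable_sum => a; apply: measurable_funM => //.
exact: measurable_coord.
Qed.

Lemma nnmeasR_lr v : nnmeasR (lr v).
Proof.
split=> [|X]; last exact: expR_ge0.
by apply: measurableT_comp => //; apply: measurable_funB => //; exact: measurable_dot.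
Qed.

Lemma nnmeasR_test psi : measurable_test psi -> nnmeasR (fun X => (psi X)%:R).
Proof.
move=> mpsi; split=> [|X]; last by rewrite ler0n.
rewrite (_ : (fun X => _) = \1_(psi @^-1` [set true] : set (@obs R p n))).
  exact: measurable_indic.
apply/funext => X; rewrite indicE; congr (nat_of_bool _)%:R.
by apply/idP/idP; rewrite inE.
Qed.

Lemma measurable_testN psi : measurable_test psi -> measurable_test (fun X : M => ~~ psi X).
Proof.
move=> mpsi; rewrite /measurable_test.
rewrite (_ : _ @^-1` _ = (~` (psi @^-1` [set true]) : set (@obs R p n))).
  exact: (@measurableC _ (@obs R p n) _ mpsi).
by apply/seteqP; split=> X /=; case: (psi X).
Qed.

Lemma esp_cst th c : esp th (fun=> c) = c%:E.
Proof. exact: gauss_iint_cst. Qed.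

Lemma espD th f g : nnmeasR f -> nnmeasR g ->
  (esp th (fun X => (f X + g X)%R) = esp th f + esp th g)%E.
Proof.
move=> nf ng; rewrite -gauss_iintD//; last 2 first.
- exact: nnmeas_EFin.
- exact: nnmeas_EFin.
Qed.

Lemma espZ th f (k : R) : nnmeasR f -> 0 <= k ->
  (esp th (fun X => (k * f X)%R) = k%:E * esp th f)%E.
Proof.
by move=> nf k0; rewrite -gauss_iintZ//; exact: nnmeas_EFin.
Qed.

Lemma esp_le th f g : nnmeasR f -> nnmeasR g -> (forall X, f X <= g X) ->
  (esp th f <= esp th g)%E.
Proof.
move=> nf ng fg; apply: gauss_iint_le; [exact: nnmeas_EFin..|].
by move=> X; rewrite lee_fin.
Qed.

Lemma esp_ge0 th f : nnmeasR f -> (0 <= esp th f)%E.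
Proof.
by move=> /nnmeas_EFin nf; have [_] := gauss_iint_nnmeas th (enum [set: 'I_p * 'I_n]) nf; exact.
Qed.

Definition prob th (psi : M -> bool) : R := fine (esp th (fun X => (psi X)%:R)).

Lemma esp_test_le1 th psi : measurable_test psi ->
  (esp th (fun X => (psi X)%:R) <= 1)%E.
Proof.
move=> mpsi; rewrite -(@esp_cst th 1); apply: esp_le => //.
- exact: nnmeasR_test.
- by move=> X; rewrite lern1 leq_b1.
Qed.

Lemma esp_prob th psi : measurable_test psi ->
  esp th (fun X => (psi X)%:R) = (prob th psi)%:E.
Proof.
move=> mpsi; rewrite fineK// ge0_fin_numE ?esp_ge0//; last exact: nnmeasR_test.
by rewrite (le_lt_trans (esp_test_le1 th mpsi)) ?ltry.
Qed.

Lemma prob_ge0 th psi : measurable_test psi -> 0 <= prob th psi.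
Proof. by move=> mpsi; rewrite -lee_fin -esp_prob// esp_ge0//; exact: nnmeasR_test. Qed.

Lemma prob_le1 th psi : measurable_test psi -> prob th psi <= 1.
Proof. by move=> mpsi; rewrite -lee_fin -esp_prob// esp_test_le1. Qed.

Lemma esp_sum (I : eqType) (r : seq I) th (F : I -> M -> R) :
  (forall i, i \in r -> nnmeasR (F i)) ->
  (esp th (fun X => (\sum_(i <- r) F i X)%R) = \sum_(i <- r) esp th (F i))%E.
Proof.
elim: r => [|i r IH] hF.
  by rewrite big_nil; under eq_fun do rewrite big_nil; exact: esp_cst.
have hr k : k \in r -> nnmeasR (F k) by move=> kr; apply: hF; rewrite inE kr orbT.
rewrite big_cons -IH// -espD; first by under eq_fun do rewrite big_cons.
- exact/hF/mem_head.
- exact: nnmeasR_sum.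
Qed.

Lemma esp_indep th f g P : nnmeasR f -> nnmeasR g ->
  depends_on P f -> depends_on (fun a => ~~ P a) g ->
  (esp th (fun X => (f X * g X)%R) = esp th f * esp th g)%E.
Proof.
move=> nf ng df dg; rewrite -(@gauss_iint_indep _ _ _ _ _ _ _ P) //.
- exact: nnmeas_EFin.
- exact: nnmeas_EFin.
- by move=> X Y XY; rewrite (df X Y).
- by move=> X Y XY; rewrite (dg X Y).
Qed.

(** [cl] sorts the entries into classes and [h] labels each factor by its class. Classes are blocks
    of rows in the lower bound and single rows in the counting test. *)
Lemma esp_prod (I J : eqType) (r : seq I) (cl : 'I_p * 'I_n -> J) (h : I -> J) th
    (F : I -> M -> R) (w : I -> R) : injective h -> uniq r ->
  (forall b, b \in r -> [/\ nnmeasR (F b), depends_on (fun a => cl a == h b) (F b) &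
     esp th (F b) = (w b)%:E]) ->
  esp th (fun X => \prod_(b <- r) F b X) = (\prod_(b <- r) w b)%:E.
Proof.
move=> hI; elim: r => [|b r IH] /=.
  by move=> _ _; rewrite big_nil; under eq_fun do rewrite big_nil; exact: esp_cst.
move=> /andP[br ur] hF.
have hr k : k \in r -> [/\ nnmeasR (F k), depends_on (fun a => cl a == h k) (F k) &
     esp th (F k) = (w k)%:E] by move=> kr; apply: hF; rewrite inE kr orbT.
have [nb db eb] := hF _ (mem_head _ _).
rewrite big_cons EFinM -IH// -eb -(@esp_indep _ _ _ (fun a => cl a == h b)) //.
- by under eq_fun do rewrite big_cons.
- by apply: nnmeasR_prod => k /hr[].
- move=> X Y XY; rewrite big_seq [RHS]big_seq; apply: eq_bigr => k kr.
  have [_ dk _] := hr _ kr; apply: dk => j i /eqP ck; apply: XY.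
  by rewrite ck (inj_eq hI); apply: contraNneq br => <-.
Qed.

Lemma lik_lr v X : lik (enum [set: 'I_p * 'I_n]) v X = lr v X.
Proof.
rewrite /lik /lr; congr expR.
transitivity (\sum_(a : 'I_p * 'I_n) (v a.1 a.2 * X a.1 a.2 - v a.1 a.2 ^+ 2 / 2)).
  rewrite big_enum/=; by apply: eq_bigl => a; rewrite classical_sets.in_setT.
rewrite big_split/= sumrN -mulr_suml; congr (_ - _ / 2).
Qed.

Lemma esp_tilt th f : nnmeasR f -> esp th f = esp 0 (fun X => lr th X * f X).
Proof.
move=> /nnmeas_EFin nf; rewrite /esp /Etheta gauss_iint_tilt ?enum_uniq//.
by apply: gauss_iint_eq => X; rewrite lik_lr EFinM.
Qed.

Lemma esp_lr v : esp 0 (lr v) = 1%E.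
Proof.
rewrite -(esp_cst v 1) (esp_tilt v (nnmeasR_cst ler01)).
by congr esp; apply/funext => X; rewrite mulr1.
Qed.

(** Lets the start [0] be traded for a matrix of the mapped form demanded by [gauss_iint_map]. *)
Lemma gauss_iint_start th (f : M -> \bar R) X :
  gauss_iint th (enum [set: 'I_p * 'I_n]) f X = Etheta th f.
Proof.
apply: (@gauss_iint_depends _ _ _ th (enum [set: 'I_p * 'I_n]) f predT).
  by move=> Y Z YZ; congr f; apply/matrixP => j i; exact: YZ.
by move=> j i /=; rewrite mem_enum classical_sets.in_setT.
Qed.

Lemma esp_shift th f : nnmeasR f -> esp th f = esp 0 (fun X => f (X + th)).
Proof.
move=> /nnmeas_EFin nf.
rewrite /esp -(gauss_iint_start _ _ (\matrix_(j, i) (0 + th j i))).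
have E := @gauss_iint_map _ _ _ th (fun j i y => y + th j i)
  (enum [set: 'I_p * 'I_n]) (fun X => (f X)%:E) 0 nf _.
rewrite (_ : (\matrix_(j, i) (0 + th j i)) = \matrix_(j, i) ((0 : M) j i + th j i)); last first.
  by apply/matrixP => j i; rewrite !mxE.
rewrite E; last by move=> j i h mh h0; exact: normal_prob_shift.
apply: gauss_iint_eq => X; congr (f _)%:E.
by apply/matrixP => j i; rewrite !mxE.
Qed.

Lemma esp_opp f : nnmeasR f -> esp 0 f = esp 0 (fun X => f (- X)).
Proof.
move=> /nnmeas_EFin nf.
rewrite /esp -(gauss_iint_start _ _ (\matrix_(j, i) (- (0 : M) j i))).
have E := @gauss_iint_map _ _ _ 0 (fun j i y => - y)
  (enum [set: 'I_p * 'I_n]) (fun X => (f X)%:E) 0 nf _.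
rewrite E; last by move=> j i h mh h0; rewrite mxE; exact: normal_prob_opp.
apply: gauss_iint_eq => X; congr (f _)%:E.
by apply/matrixP => j i; rewrite !mxE.
Qed.

Lemma dotDl u v X : dot (u + v) X = dot u X + dot v X.
Proof. by rewrite /dot -big_split; apply: eq_bigr => a _; rewrite mxE mulrDl. Qed.

Lemma dotC v X : dot v X = dot X v.
Proof. by apply: eq_bigr => a _; rewrite mulrC. Qed.

Lemma dotDr u v X : dot X (u + v) = dot X u + dot X v.
Proof. by rewrite dotC dotDl !(dotC X). Qed.

Lemma dotZl k v X : dot (k *: v) X = k * dot v X.
Proof. by rewrite /dot mulr_sumr; apply: eq_bigr => a _; rewrite mxE mulrA. Qed.

Lemma dotZr k v X : dot v (k *: X) = k * dot v X.
Proof. by rewrite dotC dotZl dotC. Qed.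

Lemma dot0l X : dot 0 X = 0.
Proof. by rewrite -(scale0r 0) dotZl mul0r. Qed.

Lemma dot_suml (I : Type) (r : seq I) (F : I -> M) X :
  dot (\sum_(i <- r) F i) X = \sum_(i <- r) dot (F i) X.
Proof.
elim: r => [|i r IH]; first by rewrite !big_nil dot0l.
by rewrite !big_cons dotDl IH.
Qed.

Lemma dot_sumr (I : Type) (r : seq I) (F : I -> M) X :
  dot X (\sum_(i <- r) F i) = \sum_(i <- r) dot X (F i).
Proof. by rewrite dotC dot_suml; apply: eq_bigr => i _; rewrite dotC. Qed.

Lemma nnmeasR_expdot v : nnmeasR (fun X => expR (dot v X)).
Proof.
split=> [|X]; last exact: expR_ge0.
by apply: measurableT_comp => //; exact: measurable_dot.
Qed.

(** The Gaussian moment generating function, read off from the unit mass of [lr v]. *)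
Lemma esp_expdot v : esp 0 (fun X => expR (dot v X)) = (expR (dot v v / 2))%:E.
Proof.
have -> : (fun X => expR (dot v X)) = (fun X => expR (dot v v / 2) * lr v X).
  by apply/funext => X; rewrite /lr -expRD addrC subrK.
by rewrite espZ ?expR_ge0// ?esp_lr ?mule1//; exact: nnmeasR_lr.
Qed.

End gaussian_expectation.

(** * Fractional moments of block priors *)

Section powR_inequalities.
Context {R : realType}.
Implicit Types x y u : R.

(** A fraction w in [0,1] satisfies w <= w^u; this is applied to x/(x+y) and y/(x+y), which sum to
    1. *)
Lemma powR_add_le x y u : 0 <= x -> 0 <= y -> 0 < u -> u <= 1 ->
  (x + y) `^ u <= x `^ u + y `^ u.
Proof.
move=> x0 y0 u0 u1.
have [xy0|xy0] := eqVneq (x + y) 0.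
  by rewrite xy0 powR0 ?gt_eqF// addr_ge0// powR_ge0.
have t0 : 0 < x + y by rewrite lt_neqAle eq_sym xy0 addr_ge0.
have key z : 0 <= z -> z <= x + y -> z / (x + y) * (x + y) `^ u <= z `^ u.
  move=> z0 zt.
  have -> : z `^ u = (z / (x + y)) `^ u * (x + y) `^ u.
    by rewrite -powRM ?divr_ge0 ?(ltW t0)// divfK// gt_eqF.
  rewrite ler_wpM2r ?powR_ge0//.
  have [->|zn0] := eqVneq z 0; first by rewrite mul0r powR0// gt_eqF.
  have zp : 0 < z by rewrite lt_neqAle eq_sym zn0.
  by rewrite ger1_powR// divr_gt0//= ler_pdivrMr// mul1r.
have := lerD (key _ x0 _) (key _ y0 _); rewrite -mulrDl -mulrDl divff// mul1r.
by apply; rewrite ?lerDl ?lerDr.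
Qed.

Lemma powR_tangent x u : 0 <= x -> 0 < u -> u <= 1 -> x `^ u <= 1 - u + u * x.
Proof.
move=> x0 u0 u1.
have [->|xn0] := eqVneq x 0; first by rewrite powR0 ?gt_eqF// mulr0 addr0 subr_ge0.
have xp : 0 < x by rewrite lt_neqAle eq_sym xn0.
rewrite /powR (negbTE xn0).
set y := u * ln x.
have ex : x = expR y * expR ((1 - u) * ln x).
  by rewrite -expRD /y -mulrDl addrC subrK mul1r lnK.
have H1 := expR_ge1Dx ((1 - u) * ln x).
have H2 := expR_ge1Dx (- y).
have E0 : 0 < expR y := expR_gt0 y.
have H3 : expR y * (1 - y) <= 1.
  by rewrite (le_trans (ler_wpM2l (ltW E0) H2))// expRxMexpNx_1.
(* Adding [H4] and [H5] cancels the terms in y exp(y) and leaves exp(y) = x^u on the left. *)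
have H4 : expR y * (u + (1 - u) * y) <= u * x.
  rewrite (_ : u * x = expR y * (u * expR ((1 - u) * ln x))); last by rewrite {1}ex; ring.
  rewrite ler_wpM2l ?(ltW E0)//; apply: le_trans (ler_wpM2l (ltW u0) H1).
  by rewrite le_eqVlt; apply/orP; left; apply/eqP; rewrite /y; ring.
have H5 : (1 - u) * (expR y * (1 - y)) <= (1 - u) * 1.
  by rewrite ler_wpM2l// subr_ge0.
lra.
Qed.

End powR_inequalities.

Section second_moment.
Context {R : realType} {p n : nat}.
Local Notation M := 'M[R]_(p, n).
Implicit Types (th v X Y : M) (f g : M -> R).

Definition has_esp f (w : R) := nnmeasR f /\ esp 0 f = w%:E.

Lemma has_esp_add f g a b : has_esp f a -> has_esp g b ->
  has_esp (fun X => f X + g X) (a + b).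
Proof.
by move=> [nf ef] [ng eg]; split; [exact: nnmeasR_add|rewrite espD// ef eg].
Qed.

Lemma has_esp_scale f a k : 0 <= k -> has_esp f a -> has_esp (fun X => k * f X) (k * a).
Proof.
move=> k0 [nf ef]; split; last by rewrite espZ// ef.
by apply: nnmeasR_mul => //; exact: nnmeasR_cst.
Qed.

Lemma has_esp_sum (I : finType) (P : pred I) (F : I -> M -> R) w :
  (forall i, P i -> has_esp (F i) (w i)) ->
  has_esp (fun X => \sum_(i | P i) F i X) (\sum_(i | P i) w i).
Proof.
move=> hF.
have nF i : i \in enum P -> nnmeasR (F i) by rewrite mem_enum => /hF[].
have E X : \sum_(i | P i) F i X = \sum_(i <- enum P) F i X by rewrite big_enum.
rewrite /has_esp (_ : (fun X => _) = (fun X => \sum_(i <- enum P) F i X)); last exact/funext.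
split; first exact: nnmeasR_sum.
rewrite esp_sum// -sumEFin [RHS](_ : _ = \sum_(i <- enum P) (w i)%:E)%E; last by rewrite big_enum.
by rewrite big_seq [RHS]big_seq; apply: eq_bigr => i; rewrite mem_enum => /hF[].
Qed.

Lemma has_esp_lr v : has_esp (lr v) 1.
Proof. by split; [exact: nnmeasR_lr|exact: esp_lr]. Qed.

Lemma has_esp_exp v c : has_esp (fun X => expR (dot v X - c)) (expR (dot v v / 2 - c)).
Proof.
have -> : (fun X => expR (dot v X - c)) = (fun X => expR (- c) * expR (dot v X)).
  by apply/funext => X; rewrite -expRD addrC.
rewrite addrC expRD; apply: has_esp_scale; first exact: expR_ge0.
by split; [exact: nnmeasR_expdot|exact: esp_expdot].
Qed.

Lemma has_esp_lrM v w : has_esp (fun X => lr v X * lr w X) (expR (dot v w)).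
Proof.
have -> : (fun X => lr v X * lr w X) =
    (fun X => expR (dot (v + w) X - (dot v v / 2 + dot w w / 2))).
  by apply/funext => X; rewrite /lr -expRD dotDl; congr expR; ring.
have -> : dot v w = dot (v + w) (v + w) / 2 - (dot v v / 2 + dot w w / 2).
  by rewrite dotDl !dotDr (dotC w v); field.
exact: has_esp_exp.
Qed.

(** The power 1+u of a likelihood ratio is again a Gaussian exponential, and ((1+u)^2 - (1+u))/2 =
    u(1+u)/2. *)
Lemma has_esp_lr_powR v u :
  has_esp (fun X => lr v X * lr v X `^ u) (expR (dot v v * (u * (1 + u) / 2))).
Proof.
have -> : (fun X => lr v X * lr v X `^ u) =
    (fun X => expR (dot ((1 + u) *: v) X - (1 + u) * (dot v v / 2))).
  apply/funext => X; rewrite /lr -expRM -expRD dotZl; congr expR; ring.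
have -> : dot v v * (u * (1 + u) / 2) =
    dot ((1 + u) *: v) ((1 + u) *: v) / 2 - (1 + u) * (dot v v / 2).
  by rewrite dotZl dotZr; field.
exact: has_esp_exp.
Qed.

(** * Likelihood ratio of a prior with one signal per block *)

Section blocks.
Variables (s : nat) (K : finType) (v : 'I_s -> K -> M) (cl : 'I_p * 'I_n -> nat).
Variables (u V eta : R).
Hypotheses (u0 : 0 < u) (u1 : u <= 1).
Hypothesis K0 : (0 < #|K|)%N.
Hypothesis vcl : forall b k a, v b k a.1 a.2 != 0 -> cl a = b.
Hypothesis vV : forall b k, dot (v b k) (v b k) <= V.
Hypothesis veta : forall b k l, k != l -> dot (v b k) (v b l) <= eta.

Let N : R := #|K|%:R.
Let N0 : 0 < N. Proof. by rewrite ltr0n. Qed.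
Let Ni0 : 0 <= N^-1. Proof. by rewrite invr_ge0 ltW. Qed.

Let S b X := N^-1 * \sum_k lr (v b k) X.

(** Majorant of S^(1+u) built from powers and products of likelihood ratios only, so its expectation
    [w b] is explicit. *)
Let W b X := N^-1 * \sum_k (N^-1 `^ u * (lr (v b k) X * lr (v b k) X `^ u) +
   (1 - u) * lr (v b k) X +
   u * (N^-1 * \sum_(l | l != k) lr (v b k) X * lr (v b l) X)).

Let w b := N^-1 * \sum_k (N^-1 `^ u * expR (dot (v b k) (v b k) * (u * (1 + u) / 2)) +
   (1 - u) * 1 +
   u * (N^-1 * \sum_(l | l != k) expR (dot (v b k) (v b l)))).

(* Bound on [E_0 S^(1+u)] for the average [S] over one block. *)
Definition block_bound : R := N `^ (- u) * expR (V * (u * (1 + u) / 2)) + (1 - u) + u * expR eta.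

Let has_esp_W b : has_esp (W b) (w b).
Proof.
apply: has_esp_scale => //; apply: has_esp_sum => k _.
apply: has_esp_add; first apply: has_esp_add.
- by apply: has_esp_scale; [exact: powR_ge0|exact: has_esp_lr_powR].
- by apply: has_esp_scale; [rewrite subr_ge0|exact: has_esp_lr].
- apply: has_esp_scale; first exact: ltW.
  by apply: has_esp_scale => //; apply: has_esp_sum => l _; exact: has_esp_lrM.
Qed.

Let mean_le (F : K -> R) c : (forall k, F k <= c) -> N^-1 * \sum_k F k <= c.
Proof.
move=> Fc; rewrite mulrC ler_pdivrMr//.
rewrite (le_trans (ler_sum _ (fun k _ => Fc k)))//.
by rewrite big_const iter_addr_0 mulr_natr cardE enumT.
Qed.

Let w_le b : w b <= block_bound.
Proof.
apply: mean_le => k; rewrite /block_bound; apply: lerD; first apply: lerD.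
- have -> : N `^ (- u) = N^-1 `^ u by rewrite -powR_inv1 ?(ltW N0)// -powRrM mulN1r.
  rewrite ler_wpM2l ?powR_ge0// ler_expR ler_wpM2r//.
  by rewrite divr_ge0// mulr_ge0 ?addr_ge0 ?(ltW u0).
- by rewrite mulr1.
- rewrite ler_wpM2l ?(ltW u0)//.
  have H : N^-1 * \sum_(l : K) expR eta <= expR eta by exact: mean_le.
  apply: le_trans H.
  rewrite ler_wpM2l// [leRHS](bigID (fun l => l != k))/= ler_wpDr//.
    by apply: sumr_ge0 => l _; exact: expR_ge0.
  by apply: ler_sum => l lk; rewrite ler_expR veta// eq_sym.
Qed.

Let S_ge0 b X : 0 <= S b X.
Proof. by rewrite mulr_ge0// sumr_ge0// => k _; exact: expR_ge0. Qed.

(* Pointwise: for each atom [k], [S^u <= (e_k / N)^u + 1 - u + u * mean of the others]. *)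
Let S_powR b X : S b X * S b X `^ u <= W b X.
Proof.
rewrite /W {1}/S -mulrA ler_wpM2l// mulr_suml; apply: ler_sum => k _.
set e := lr (v b k) X; have e0 : 0 <= e by exact: expR_ge0.
set r := N^-1 * \sum_(l | l != k) lr (v b l) X.
have r0 : 0 <= r by rewrite mulr_ge0// sumr_ge0// => l _; exact: expR_ge0.
have -> : S b X = N^-1 * e + r.
  by rewrite /S (bigD1 k)//= mulrDr.
have H : (N^-1 * e + r) `^ u <= N^-1 `^ u * e `^ u + (1 - u + u * r).
  apply: le_trans (powR_add_le _ _ _ _) _ => //; first by rewrite mulr_ge0.
  by rewrite powRM// lerD2l powR_tangent.
apply: le_trans (ler_wpM2l e0 H) _; rewrite -mulr_sumr -/r.
by rewrite le_eqVlt; apply/orP; left; apply/eqP; rewrite /r; ring.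
Qed.

Let L X := \prod_(b : 'I_s) S b X.

Let powR_prod (r : seq 'I_s) X :
  (\prod_(b <- r) S b X) `^ u = \prod_(b <- r) (S b X `^ u).
Proof.
elim: r => [|b r IH]; first by rewrite !big_nil powR1.
by rewrite !big_cons powRM// ?IH// prodr_ge0.
Qed.

Let nnmeasR_S b : nnmeasR (S b).
Proof.
have := has_esp_scale Ni0 (has_esp_sum (fun k (_ : true) => has_esp_lr (v b k))).
by case.
Qed.

Let nnmeasR_L : nnmeasR L.
Proof. by apply: nnmeasR_prod => b _; exact: nnmeasR_S. Qed.

Let nnmeasR_LL : nnmeasR (fun X => L X * L X `^ u).
Proof.
apply: nnmeasR_mul => //; split=> [|X]; last exact: powR_ge0.
exact: (measurableT_comp (measurable_powR u) (proj1 nnmeasR_L)).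
Qed.

Let depends_lr (b : 'I_s) k X Y : (forall j i, cl (j, i) == b :> nat -> X j i = Y j i) ->
  lr (v b k) X = lr (v b k) Y.
Proof.
move=> XY; rewrite /lr; have -> // : dot (v b k) X = dot (v b k) Y.
apply: eq_bigr => a _.
have [->|va] := eqVneq (v b k a.1 a.2) 0; first by rewrite !mul0r.
by rewrite XY// -surjective_pairing (vcl va).
Qed.

(** Each block contributes at most [W b], and the blocks occupy disjoint classes of entries, so the
    expectation of the product factorizes. *)
Let L_moment : (esp 0 (fun X => (L X * L X `^ u)%R) <= (block_bound ^+ s)%:E)%E.
Proof.
have nW b : nnmeasR (W b) by case: (has_esp_W b).
apply: (@le_trans _ _ (esp 0 (fun X => \prod_(b <- index_enum 'I_s) W b X))).
  apply: esp_le => //; first by apply: nnmeasR_prod.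
  move=> X; rewrite /L powR_prod -big_split/=; apply: ler_prod => b _.
  by rewrite S_powR mulr_ge0 ?powR_ge0.
rewrite (@esp_prod _ _ _ _ nat _ cl (@nat_of_ord s) 0 W w (@ord_inj s) (index_enum_uniq _)).
  rewrite lee_fin (le_trans (ler_prod _ (fun b _ => _ : 0 <= w b <= block_bound)))//.
    move=> b; rewrite w_le andbT -lee_fin; have [nb <-] := has_esp_W b.
    by move=> _; exact: esp_ge0.
  by rewrite prodr_const card_ord.
move=> b _; split => //; last by case: (has_esp_W b).
move=> X Y XY; rewrite /W; congr (_ * _); apply: eq_bigr => k _.
have E l : lr (v b l) X = lr (v b l) Y by apply: depends_lr.
rewrite E; congr (_ + u * (N^-1 * _)); apply: eq_bigr => l _.
by rewrite E.
Qed.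

Let dot_orth (b c : 'I_s) k l : b != c -> dot (v b k) (v c l) = 0.
Proof.
move=> bc; apply: big1 => a _.
have [->|vb] := eqVneq (v b k a.1 a.2) 0; first by rewrite mul0r.
have [->|vc] := eqVneq (v c l a.1 a.2) 0; first by rewrite mulr0.
by move: bc; rewrite -(inj_eq (@ord_inj s)) -(vcl vb) -(vcl vc) eqxx.
Qed.

Let theta (f : {ffun 'I_s -> K}) : M := \sum_b v b (f b).

Let lr_theta (f : {ffun 'I_s -> K}) X : lr (theta f) X = \prod_b lr (v b (f b)) X.
Proof.
rewrite /lr -expR_sum; congr expR; rewrite /theta !dot_suml sumrB; congr (_ - _).
rewrite -mulr_suml; congr (_ / 2); apply: eq_bigr => b _.
rewrite dot_sumr (bigD1 b)//= big1 ?addr0// => c cb.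
by rewrite dot_orth// eq_sym.
Qed.

(** Expanding the product of averages identifies [L] as the likelihood ratio of the uniform mixture
    over all choices [f] of one atom per block. *)
Let LE X : L X = (N^-1 ^+ s) * \sum_f lr (theta f) X.
Proof.
rewrite /L /S big_split/= prodr_const card_ord; congr (_ * _).
rewrite bigA_distr_bigA; apply: eq_bigr => f _.
by rewrite lr_theta.
Qed.

Let esp_L : esp 0 L = 1%E.
Proof.
rewrite (_ : L = (fun X => N^-1 ^+ s * \sum_f lr (theta f) X)); last exact/funext/LE.
have := has_esp_scale (exprn_ge0 s Ni0)
  (has_esp_sum (fun (f : {ffun 'I_s -> K}) (_ : true) => has_esp_lr (theta f))).
case=> _ ->; congr EFin.
rewrite sumr_const card_ffun card_ord natrX -/N -exprMn.
by rewrite mulVf ?expr1n// gt_eqF.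
Qed.

(* From [L <= K psi + K (1 - psi) L + K^(-u) L^(1+u)] with [K^u = 2 (C + 1)]. *)
Definition lower_const (C : R) : R := (2 * (2 * (C + 1)) `^ u^-1)^-1.

Lemma block_lower psi (B : R) : measurable_test psi ->
  (forall f : {ffun 'I_s -> K},
    esp (\sum_b v b (f b)) (fun X => (~~ psi X)%:R) <= B%:E)%E ->
  ((lower_const (block_bound ^+ s))%:E <= esp 0 (fun X => (psi X)%:R) + B%:E)%E.
Proof.
move=> mpsi hB.
have n1 := nnmeasR_test mpsi; have n2 := nnmeasR_test (measurable_testN mpsi).
pose C := block_bound ^+ s.
have C0 : 0 <= C.
  rewrite -lee_fin; apply: le_trans L_moment; exact: esp_ge0.
pose Kc := (2 * (C + 1)) `^ u^-1.
have Kc0 : 0 < Kc by apply: powR_gt0; lra.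
have KcU : Kc `^ u = 2 * (C + 1) by rewrite -powRrM mulVf ?gt_eqF// powRr1//; lra.
have KU0 : 0 < Kc `^ u by rewrite KcU; lra.
have Kc1 : 1 <= Kc.
  apply: (@le_trans _ _ (1 `^ u^-1)); first by rewrite powR1.
  by apply: ge0_ler_powR; rewrite ?nnegrE ?invr_ge0 ?(ltW u0)//; lra.
(* Under the null, the mean of (1 - psi) L is the type II error averaged over the prior. *)
have espB : (esp 0 (fun X => (~~ psi X)%:R * L X)%R <= B%:E)%E.
  rewrite (_ : (fun X => _) = (fun X => N^-1 ^+ s *
      \sum_(f <- index_enum {ffun 'I_s -> K}) lr (theta f) X * (~~ psi X)%:R)).
    have nf (f : {ffun 'I_s -> K}) : nnmeasR (fun X => lr (theta f) X * (~~ psi X)%:R).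
      by apply: nnmeasR_mul => //; exact: nnmeasR_lr.
    rewrite espZ ?exprn_ge0//; last by apply: nnmeasR_sum => f _; exact: nf.
    rewrite esp_sum//.
    apply: (@le_trans _ _ ((N^-1 ^+ s)%:E * \sum_(f : {ffun 'I_s -> K}) B%:E)%E).
      rewrite lee_pmul2l ?lte_fin ?exprn_gt0 ?invr_gt0//.
      by apply: lee_sum => f _; rewrite -esp_tilt//; exact: hB.
    rewrite sumEFin -EFinM lee_fin sumr_const card_ffun card_ord -mulr_natl natrX mulrA.
    by rewrite -exprMn mulVf ?gt_eqF// expr1n mul1r.
  by apply/funext => X; rewrite LE mulrCA -mulr_suml [_%:R * _]mulrC.
have eE := esp_prob 0 mpsi; set e := prob 0 psi in eE.
have key : (1%E <= (Kc * (e + B) + (Kc `^ u)^-1 * C)%:E)%E.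
  have nA : nnmeasR (fun X => (psi X)%:R + (~~ psi X)%:R * L X).
    by apply: nnmeasR_add => //; exact: nnmeasR_mul.
  have nB : nnmeasR (fun X => Kc * ((psi X)%:R + (~~ psi X)%:R * L X)).
    by apply: nnmeasR_mul => //; apply: nnmeasR_cst; exact: ltW.
  have k0 : 0 <= (Kc `^ u)^-1 by rewrite invr_ge0 powR_ge0.
  have nC : nnmeasR (fun X => (Kc `^ u)^-1 * (L X * L X `^ u)).
    by apply: nnmeasR_mul => //; apply: nnmeasR_cst.
  rewrite -esp_L; apply: (@le_trans _ _ (esp 0 (fun X =>
     Kc * ((psi X)%:R + (~~ psi X)%:R * L X) + (Kc `^ u)^-1 * (L X * L X `^ u)))).
    apply: esp_le => //; first exact: nnmeasR_add.
    have L0 X : 0 <= L X by case: nnmeasR_L.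
    (* Where psi rejects, either L <= Kc, or (L/Kc)^u >= 1 and the moment term alone dominates L.
       Where psi accepts, Kc >= 1 suffices. *)
    move=> X; case: (psi X) => /=.
      rewrite mul0r addr0 mulr1.
      have [LK|KL] := leP (L X) Kc.
        by rewrite ler_wpDr// mulr_ge0// mulr_ge0 ?powR_ge0.
      rewrite ler_wpDl ?(ltW Kc0)// mulrCA ler_peMr// mulrC ler_pdivlMr//.
      by rewrite mul1r ge0_ler_powR ?nnegrE// ?(ltW u0) ?(ltW Kc0) ?(ltW KL).
    rewrite add0r mul1r ler_wpDr ?ler_peMl//.
    by rewrite mulr_ge0// mulr_ge0 ?powR_ge0.
  rewrite espD// !espZ//; [|exact: ltW].
  rewrite espD//; last exact: nnmeasR_mul.
  rewrite eE EFinD !EFinM EFinD; apply: leeD.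
    by rewrite lee_pmul2l ?lte_fin// leeD2l.
  apply: lee_wpmul2l => //; rewrite lee_fin//.
rewrite eE -EFinD lee_fin /lower_const -/C -/Kc.
move: key; rewrite lee_fin KcU => key.
rewrite -[leLHS]mul1r ler_pdivrMr; last by rewrite mulr_gt0.
(* The moment term uses up at most half of the unit mass of L, so Kc (e + B) >= 1/2. *)
have : (2 * (C + 1))^-1 * C <= 2^-1.
  rewrite mulrC ler_pdivrMr; lra.
lra.
Qed.

End blocks.
End second_moment.

(** * Exceedance probabilities and scan tests *)

Section exceedance.
Context {R : realType} {p n : nat}.
Local Notation M := 'M[R]_(p, n).
Implicit Types (th v X Y : M) (tau mu : R).

Definition exceeds tau v X := tau < `|dot v X|.

Definition tail_bound tau : R := 2 * expR (- (tau ^+ 2 / 2)).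

(* Obtained by tilting the mean from [mu] to [tau + 2]. *)
Definition power_bound tau mu : R :=
  expR (- ((tau + 2 - mu) ^+ 2 / 2 + 2 * (tau + 2 - mu))) / 2.

Lemma measurable_fun_test (psi : M -> bool) :
  measurable_fun [set: @obs R p n] (psi : @obs R p n -> bool) -> measurable_test psi.
Proof.
move=> mpsi; rewrite /measurable_test -[X in <<s _ >> X]setTI.
exact: (mpsi measurableT [set true]).
Qed.

Lemma measurable_test_fun (psi : M -> bool) :
  measurable_test psi -> measurable_fun [set: @obs R p n] (psi : @obs R p n -> bool).
Proof.
by move=> mpsi; apply: (measurable_fun_bool true) => //; rewrite setTI.
Qed.

Lemma measurable_exceeds tau v : measurable_test (exceeds tau v).
Proof.
apply: measurable_fun_test; apply: measurable_fun_ltr => //.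
by apply: measurableT_comp => //; exact: measurable_dot.
Qed.

(** The law of [dot v X] sees the mean only through its component along [v]. *)
Lemma exceeds_shift tau v th : dot v v = 1 ->
  prob th (exceeds tau v) = prob (dot v th *: v) (exceeds tau v).
Proof.
move=> v1; have nE := nnmeasR_test (measurable_exceeds tau v).
rewrite /prob (esp_shift th)// (esp_shift (_ *: v))//; congr (fine (esp 0 _)).
by apply/funext => X; rewrite /exceeds !dotDr dotZr v1 mulr1.
Qed.

Lemma exceeds_opp tau v mu :
  prob (mu *: v) (exceeds tau v) = prob (- mu *: v) (exceeds tau v).
Proof.
have nE := nnmeasR_test (measurable_exceeds tau v).
rewrite /prob (esp_tilt (mu *: v))// (esp_tilt (- mu *: v))// esp_opp;
  last exact: nnmeasR_mul (nnmeasR_lr _) nE.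
congr (fine (esp 0 _)); apply/funext => X.
have dN : dot v (- X) = - dot v X by rewrite -scaleN1r dotZr mulN1r.
rewrite /exceeds /lr !dotZl !dotZr dN normrN; congr (expR _ * _).
by ring.
Qed.

(** Chernoff with parameters tau and -tau: the indicator is at most exp(tau Z - tau^2) + exp(-tau Z
    - tau^2), whence the factor 2. *)
Lemma exceeds_tail tau v : 0 <= tau -> dot v v <= 1 -> prob 0 (exceeds tau v) <= tail_bound tau.
Proof.
move=> t0 v1; rewrite -lee_fin -esp_prob; last exact: measurable_exceeds.
pose c := tau ^+ 2.
have h1 := has_esp_exp (tau *: v) c; have h2 := has_esp_exp (- tau *: v) c.
have [nh eh] := has_esp_add h1 h2.
apply: (@le_trans _ _ (esp 0 (fun X =>
    expR (dot (tau *: v) X - c) + expR (dot (- tau *: v) X - c)))).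
  apply: esp_le => //; first exact: (nnmeasR_test (measurable_exceeds tau v)).
  move=> X; rewrite /exceeds !dotZl; case: ltP => /= [tX|_]; last by rewrite addr_ge0 ?expR_ge0.
  have E1 y : 0 <= y -> (1%:R : R) <= expR y.
    by move=> y0; rewrite (le_trans _ (expR_ge1Dx y))// lerDl.
  move: tX; have [d0|d0] := leP 0 (dot v X).
    rewrite ger0_norm// => tX; rewrite ler_wpDr ?expR_ge0// E1//.
    by rewrite /c expr2 -mulrBr mulr_ge0// subr_ge0 ltW.
  rewrite ltr0_norm// => tX; rewrite ler_wpDl ?expR_ge0// E1//.
  by rewrite /c expr2 mulNr -mulrN -mulrBr mulr_ge0// subr_ge0 ltW.
have tE (e : R) : 2 * e = e + e by ring.
rewrite eh lee_fin /tail_bound tE.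
have H : tau * (tau * dot v v) <= tau ^+ 2.
  by rewrite mulrA -expr2 ler_piMr// exprn_ge0.
have -> : dot (- tau *: v) (- tau *: v) = tau * (tau * dot v v).
  by rewrite dotZl dotZr; ring.
rewrite dotZl dotZr /c.
move: (tau * _) (tau ^+ 2) H => x y H.
by apply: lerD; rewrite ler_expR; lra.
Qed.

(* Symmetrizing the tilt in [mu], the indicator of [|Z| > tau] and [cosh (mu Z)] are both
   increasing in [|Z|], hence positively correlated. *)
Lemma exceeds_increases tau v mu : dot v v = 1 -> 0 <= tau ->
  prob 0 (exceeds tau v) <= prob (mu *: v) (exceeds tau v).
Proof.
move=> v1 t0; set q := prob 0 _.
have mE := measurable_exceeds tau v; have nE := nnmeasR_test mE.
have q0 : 0 <= q := prob_ge0 0 mE; have q1 : q <= 1 := prob_le1 0 mE.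
pose h X := lr (mu *: v) X + lr (- mu *: v) X.
pose h0 := expR (mu * tau - mu ^+ 2 / 2) + expR (- mu * tau - mu ^+ 2 / 2).
have hE : has_esp h 2.
  by rewrite (_ : 2 = 1 + 1)//; apply: has_esp_add; exact: has_esp_lr.
have nh : nnmeasR h by case: hE.
have h00 : 0 <= h0 by rewrite addr_ge0 ?expR_ge0.
have lrE (m : R) X : lr (m *: v) X = expR (m * dot v X) * expR (- (m ^+ 2 / 2)).
  by rewrite /lr !dotZl !dotZr v1 mulr1 -expRD expr2.
have mono (x y : R) : `|x| <= `|y| -> expR x + expR (- x) <= expR y + expR (- y).
  wlog: y / 0 <= y => [H|y0].
    have [y0|y0] := leP 0 y; first exact: H.
    by move=> xy; rewrite [leRHS]addrC -{2}(opprK y) H ?normrN// oppr_ge0 ltW.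
  rewrite (ger0_norm y0) ler_norml => /andP[xy1 xy2].
  have E1 := expRxMexpNx_1 x; have E2 := expRxMexpNx_1 y.
  have E3 : expR x <= expR y by rewrite ler_expR.
  have E4 : expR (- x) <= expR y by rewrite ler_expR; lra.
  have E5 := expR_gt0 (- y).
  (* Expanding this product gives exp(y) + exp(-y) - exp(x) - exp(-x). *)
  have : 0 <= expR (- y) * ((expR y - expR x) * (expR y - expR (- x))).
    by rewrite mulr_ge0 ?(ltW E5)// mulr_ge0// subr_ge0.
  have -> : expR (- y) * ((expR y - expR x) * (expR y - expR (- x))) =
     (expR y * expR (- y)) * (expR y - expR x - expR (- x)) +
     (expR x * expR (- x)) * expR (- y) by ring.
  by rewrite E1 E2; lra.
(* This is (h - h0)(1_E - q) >= 0 with E the exceedance event and [h0] the value of h at |Z| = tau.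
   Its expectation reads 2q + h0 q <= 2P + q h0. *)
have pt X : q * h X + h0 * (exceeds tau v X)%:R <= h X * (exceeds tau v X)%:R + q * h0.
  have hm (x y : R) : `|x| <= `|y| ->
     expR (mu * x) + expR (- (mu * x)) <= expR (mu * y) + expR (- (mu * y)).
    by move=> xy; apply: mono; rewrite !normrM ler_wpM2l.
  have eh0 : h0 = (expR (mu * tau) + expR (- (mu * tau))) * expR (- (mu ^+ 2 / 2)).
    by rewrite /h0 mulrDl -!expRD mulNr.
  have eh : h X = (expR (mu * dot v X) + expR (- (mu * dot v X))) * expR (- (mu ^+ 2 / 2)).
    by rewrite /h !lrE sqrrN mulNr -mulrDl.
  have E0 := expR_ge0 (- (mu ^+ 2 / 2)).
  rewrite /exceeds; case: ltP => /= tX.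
    have : h0 <= h X.
      by rewrite eh0 eh ler_wpM2r// hm// (ger0_norm t0) ltW.
    nra.
  have : h X <= h0 by rewrite eh0 eh ler_wpM2r// hm// (ger0_norm t0).
  nra.
have e2 : esp 0 (fun X => h X * (exceeds tau v X)%:R) =
    (prob (mu *: v) (exceeds tau v) *+ 2)%:E.
  rewrite (_ : (fun X => _) = (fun X => lr (mu *: v) X * (exceeds tau v X)%:R +
    lr (- mu *: v) X * (exceeds tau v X)%:R)); last by apply/funext => X; rewrite -mulrDl.
  rewrite espD; [|exact: nnmeasR_mul (nnmeasR_lr _) nE..].
  rewrite -(esp_tilt (mu *: v))// -(esp_tilt (- mu *: v))// !esp_prob// -exceeds_opp -EFinD.
  by rewrite mulr2n.
have : (esp 0 (fun X => (q * h X + h0 * (exceeds tau v X)%:R)%R) <=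
        esp 0 (fun X => (h X * (exceeds tau v X)%:R + q * h0)%R))%E.
  apply: esp_le => //.
  - apply: nnmeasR_add; apply: nnmeasR_mul => //; exact: nnmeasR_cst.
  - apply: nnmeasR_add; first exact: nnmeasR_mul.
    by apply: nnmeasR_cst; rewrite mulr_ge0.
rewrite espD; last 2 first.
- by apply: nnmeasR_mul => //; exact: nnmeasR_cst.
- by apply: nnmeasR_mul => //; exact: nnmeasR_cst.
rewrite espD; last 2 first.
- exact: nnmeasR_mul.
- by apply: nnmeasR_cst; rewrite mulr_ge0.
rewrite !espZ// e2 esp_cst (proj2 hE) esp_prob// -!EFinM -!EFinD lee_fin -/q.
by rewrite mulr2n; lra.
Qed.

Lemma lrZ a v X : dot v v = 1 -> lr (a *: v) X = expR (a * dot v X - a ^+ 2 / 2).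
Proof. by move=> v1; rewrite /lr !dotZl dotZr v1 mulr1 expr2. Qed.

Lemma expRN2_le : expR (- 2) <= 4^-1 :> R.
Proof.
rewrite expRN lef_pV2 ?posrE ?expR_gt0//.
have -> : 2 = 1 + 1 :> R by [].
rewrite expRD; have := expR_ge1Dx (1 : R); nra.
Qed.

Lemma exceeds_power tau v mu mu0 : dot v v = 1 -> mu0 <= tau -> mu0 <= mu ->
  power_bound tau mu0 <= prob (mu *: v) (exceeds tau v).
Proof.
move=> v1 m0t m0m; set P := prob _ _.
have mE := measurable_exceeds tau v; have nE := nnmeasR_test mE.
have E2 := expRN2_le.
have nP : nnmeasR (fun X => lr (mu *: v) X * (exceeds tau v X)%:R).
  exact: nnmeasR_mul (nnmeasR_lr _) nE.
have eP : esp 0 (fun X => lr (mu *: v) X * (exceeds tau v X)%:R) = P%:E.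
  by rewrite -(esp_tilt (mu *: v))// esp_prob.
pose nu := tau + 2.
(* If mu >= tau + 2, then Z <= tau gives lr(mu) <= exp(-2) lr(mu - 2), so a miss has probability at
   most 1/4. *)
have [numu|munu] := leP nu mu.
  have hr : has_esp (fun X => lr (mu *: v) X * (exceeds tau v X)%:R +
      expR (- 2) * lr ((mu - 2) *: v) X) (P + expR (- 2) * 1).
    apply: has_esp_add; first by split.
    by apply: has_esp_scale; [exact: expR_ge0|exact: has_esp_lr].
  have : (esp 0 (lr (mu *: v)) <= (P + expR (- 2) * 1)%:E)%E.
    rewrite -(proj2 hr); apply: esp_le; [exact: nnmeasR_lr|exact: (proj1 hr)|].
    move=> X; rewrite /exceeds; case: ltP => /= [_|tX].
      by rewrite mulr1 lerDl mulr_ge0 ?expR_ge0.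
    rewrite mulr0 add0r !lrZ// -expRD ler_expR.
    by have := le_trans (ler_norm _) tX; rewrite /nu in numu; nra.
  rewrite esp_lr lee_fin => H.
  apply: (@le_trans _ _ (1 / 2)); last by lra.
  rewrite /power_bound ler_wpM2r// expR_le1 oppr_le0; nra.
(* Tilt to nu = tau + 2. Each side of the window |Z - nu| < 2 has mass at most exp(-2) <= 1/4;
   inside it Z > tau, and [K] bounds lr(nu)/lr(mu). Hence 1 <= K P + 1/2. *)
pose K := expR ((nu - mu) ^+ 2 / 2 + 2 * (nu - mu)).
have K0 : 0 < K by exact: expR_gt0.
have hr : has_esp (fun X => K * (lr (mu *: v) X * (exceeds tau v X)%:R) +
    (expR (- 2) * lr ((nu - 2) *: v) X + expR (- 2) * lr ((nu + 2) *: v) X))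
    (K * P + (expR (- 2) * 1 + expR (- 2) * 1)).
  apply: has_esp_add; first by apply: has_esp_scale; [exact: expR_ge0|split].
  by apply: has_esp_add; apply: has_esp_scale; [exact: expR_ge0|exact: has_esp_lr
    |exact: expR_ge0|exact: has_esp_lr].
have : (esp 0 (lr (nu *: v)) <= (K * P + (expR (- 2) * 1 + expR (- 2) * 1))%:E)%E.
  rewrite -(proj2 hr); apply: esp_le; [exact: nnmeasR_lr|exact: (proj1 hr)|].
  move=> X.
  have g1 : 0 <= K * (lr (mu *: v) X * (exceeds tau v X)%:R).
    by rewrite mulr_ge0 ?expR_ge0// mulr_ge0 ?expR_ge0.
  have g2 : 0 <= expR (- 2) * lr ((nu - 2) *: v) X by rewrite mulr_ge0 ?expR_ge0.
  have g3 : 0 <= expR (- 2) * lr ((nu + 2) *: v) X by rewrite mulr_ge0 ?expR_ge0.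
  have [Z1|Z1] := leP (dot v X) (nu - 2).
    rewrite ler_wpDl// ler_wpDr// !lrZ// -expRD ler_expR; nra.
  have [Z2|Z2] := leP (nu + 2) (dot v X).
    rewrite ler_wpDl// ler_wpDl// !lrZ// -expRD ler_expR; nra.
  rewrite ler_wpDr ?addr_ge0// (_ : exceeds tau v X = true); last first.
    rewrite /nu in Z1; rewrite /exceeds (lt_le_trans _ (ler_norm _))//; lra.
  by rewrite mulr1 !lrZ// -expRD ler_expR; nra.
rewrite esp_lr lee_fin => H.
apply: (@le_trans _ _ (K^-1 / 2)).
  rewrite /power_bound ler_wpM2r// -expRN ler_expR lerN2 -/nu; rewrite /nu in munu *; nra.
have : 2^-1 <= K * P by lra.
by rewrite -ler_pdivrMl// => /le_trans; apply.
Qed.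

(** On Z <= tau the ratio lr(mu)/lr(tau) is largest at Z = tau, where it equals the stated bound. *)
Lemma exceeds_miss tau v mu : dot v v = 1 -> tau <= mu ->
  prob (mu *: v) (fun X => ~~ exceeds tau v X) <= expR (- ((mu - tau) ^+ 2 / 2)).
Proof.
move=> v1 tm.
have mE := measurable_testN (measurable_exceeds tau v); have nE := nnmeasR_test mE.
rewrite -lee_fin -esp_prob// (esp_tilt (mu *: v))//.
have hr := has_esp_scale (expR_ge0 (- ((mu - tau) ^+ 2 / 2))) (has_esp_lr (tau *: v)).
rewrite mulr1 in hr; rewrite -(proj2 hr); apply: esp_le.
- exact: nnmeasR_mul (nnmeasR_lr _) nE.
- exact: (proj1 hr).
move=> X; rewrite /exceeds; case: ltP => /= [_|tX].
  by rewrite mulr0 mulr_ge0 ?expR_ge0.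
rewrite mulr1 !lrZ// -expRD ler_expR.
by have := le_trans (ler_norm _) tX; nra.
Qed.

End exceedance.

Section tests.
Context {R : realType} {p n : nat}.
Local Notation M := 'M[R]_(p, n).
Implicit Types (th v X Y : M) (tau mu : R).

(** Combines exp(x)(1 - x) <= 1 with (1 - x)(1 + x + 2x^2) = 1 + x^2(1 - 2x) >= 1. *)
Lemma expR_quadratic (x : R) : x <= 1 / 2 -> expR x <= 1 + x + 2 * x ^+ 2.
Proof.
move=> x2; have E0 := expR_gt0 x; have E1 := expRxMexpNx_1 x.
have E2 := expR_ge1Dx (- x).
have H : 1 <= (1 - x) * (1 + x + 2 * x ^+ 2).
  have : 0 <= x ^+ 2 * (1 - 2 * x) by rewrite mulr_ge0 ?sqr_ge0//; lra.
  by rewrite !expr2; nra.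
have H2 : expR x * (1 - x) <= 1 by rewrite -[leRHS]E1 ler_pM2l//.
have H3 : expR x * 1 <= expR x * ((1 - x) * (1 + x + 2 * x ^+ 2)) by rewrite ler_pM2l.
have H4 : 0 <= 1 + x + 2 * x ^+ 2.
  have : 0 <= (x + 1 / 2) ^+ 2 by exact: sqr_ge0.
  by rewrite !expr2; nra.
have := ler_wpM2r H4 H2; rewrite mul1r -mulrA; lra.
Qed.

Definition row_mx_of (j : 'I_p) (w : 'I_n -> R) : M :=
  \matrix_(k, i) if k == j then w i else 0.

Lemma dot_row j w X : dot (row_mx_of j w) X = \sum_i w i * X j i.
Proof.
rewrite /dot -(pair_bigA _ (fun k i => row_mx_of j w k i * X k i))/= (bigD1 j)//=.
rewrite [X in _ + X]big1 ?addr0; last first.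
  by move=> k kj; apply: big1 => i _; rewrite mxE (negbTE kj) mul0r.
by apply: eq_bigr => i _; rewrite mxE eqxx.
Qed.

Lemma dot_row_row j w : dot (row_mx_of j w) (row_mx_of j w) = \sum_i w i ^+ 2.
Proof. by rewrite dot_row; apply: eq_bigr => i _; rewrite mxE eqxx expr2. Qed.

Lemma probN th psi : measurable_test psi ->
  prob th (fun X : M => ~~ psi X) = 1 - prob th psi.
Proof.
move=> mpsi; have mN := measurable_testN mpsi.
have : (prob th psi + prob th (fun X => ~~ psi X))%:E = 1%E :> \bar R.
  rewrite EFinD -!esp_prob// -espD; [|exact: nnmeasR_test..].
  rewrite -(@esp_cst R p n th 1); congr (esp th _); apply/funext => X.
  by case: (psi X); rewrite /= ?addr0 ?add0r.
by move=> [<-]; rewrite addrC addKr.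
Qed.

Lemma measurable_test_has (T : eqType) (G : seq T) (b : T -> M -> bool) :
  (forall t, measurable_test (b t)) -> measurable_test (fun X => has (b^~ X) G).
Proof.
move=> mb; apply: measurable_fun_test; elim: G => [|t G IH] /=.
  exact: measurable_cst.
by apply: measurable_or => //; exact: measurable_test_fun.
Qed.

Lemma prob_has (T : eqType) (G : seq T) (b : T -> M -> bool) th (eps : R) :
  (forall t, measurable_test (b t)) -> (forall t, t \in G -> prob th (b t) <= eps) ->
  prob th (fun X => has (b^~ X) G) <= (size G)%:R * eps.
Proof.
move=> mb; elim: G => [|t G IH] hG /=.
  rewrite mul0r -lee_fin -esp_prob; last exact: (measurable_test_has [::] mb).
  by rewrite (esp_cst th 0).
have mt := measurable_test_has (t :: G) mb; have mG := measurable_test_has G mb.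
apply: (@le_trans _ _ (prob th (b t) + prob th (fun X => has (b^~ X) G))); last first.
  rewrite -natr1 mulrDl mul1r addrC lerD ?hG ?mem_head// IH// => u uG.
  by rewrite hG// inE uG orbT.
rewrite -lee_fin EFinD -!esp_prob// -espD; [|exact: nnmeasR_test..].
apply: esp_le; [exact: nnmeasR_test|exact: nnmeasR_add (nnmeasR_test _) (nnmeasR_test _)|].
move=> X; case: (b t X); case: (has _ _) => /=; rewrite ?addr0 ?add0r//.
by rewrite lerDl.
Qed.

(** * Number of rows exceeding the threshold along one contrast *)

Section counting.
Variables (tau : R) (w : 'I_n -> R).
Hypothesis w1 : \sum_i w i ^+ 2 = 1.
Hypothesis w0 : \sum_i w i = 0.

Let exc j := exceeds tau (row_mx_of j w).

Definition exceed_count X : R := \sum_j (exc j X)%:R.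

Let mexc j : measurable_test (exc j). Proof. exact: measurable_exceeds. Qed.

Lemma measurable_exceed_count :
  measurable_fun [set: @obs R p n] (exceed_count : @obs R p n -> R).
Proof. by apply: measurable_sum => j; have [] := nnmeasR_test (mexc j). Qed.

Let exc_dep j : depends_on (fun a => a.1 == j) (exc j).
Proof.
move=> X Y XY; rewrite /exc /exceeds !dot_row; congr (_ < `|_|).
by apply: eq_bigr => i _; rewrite XY//=.
Qed.

(** [lam] may have either sign, so this serves the upper tail under the null and the lower tail
    under the alternative. Rows are independent, and a row with probability q has mean 1 +
    q(exp(lam) - 1) <= exp(q(exp(lam) - 1)). *)
Lemma chernoff th (lam c : R) b : measurable_test b ->
  (forall X, b X -> c <= lam * exceed_count X) ->
  prob th b <= expR ((expR lam - 1) * (\sum_j prob th (exc j)) - c).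
Proof.
move=> mb hb.
pose F j X := expR lam * (exc j X)%:R + (~~ exc j X)%:R.
have nF j : nnmeasR (F j).
  apply: nnmeasR_add; last exact: nnmeasR_test (measurable_testN (mexc j)).
  by apply: nnmeasR_mul; [exact/nnmeasR_cst/expR_ge0|exact: nnmeasR_test].
have FE j X : F j X = expR (lam * (exc j X)%:R).
  by rewrite /F; case: (exc j X); rewrite /= ?mulr1 ?mulr0 ?expR0 ?addr0 ?add0r.
have eF j : esp th (F j) = (expR lam * prob th (exc j) + (1 - prob th (exc j)))%:E.
  rewrite /F espD; last 2 first.
  - by apply: nnmeasR_mul; [exact/nnmeasR_cst/expR_ge0|exact: nnmeasR_test].
  - exact: nnmeasR_test (measurable_testN (mexc j)).
  rewrite espZ ?expR_ge0//; last exact: nnmeasR_test.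
  by rewrite !esp_prob// ?probN//; exact: measurable_testN.
pose Pi X := \prod_(j <- index_enum 'I_p) F j X.
have nPi : nnmeasR Pi by exact: nnmeasR_prod.
have ePi : esp th Pi = (\prod_(j <- index_enum 'I_p)
    (expR lam * prob th (exc j) + (1 - prob th (exc j))))%:E.
  apply: (@esp_prod _ _ _ _ _ _ (fun a => a.1) id) => //; first exact: index_enum_uniq.
  move=> j _; split => // X Y XY; rewrite !FE; congr (expR (_ * (nat_of_bool _)%:R)).
  exact: exc_dep.
have PiE X : Pi X = expR (lam * exceed_count X).
  rewrite /Pi /exceed_count mulr_sumr expR_sum; apply: eq_bigr => j _; exact: FE.
rewrite -lee_fin -esp_prob//.
apply: (@le_trans _ _ (esp th (fun X => expR (- c) * Pi X))).
  apply: esp_le.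
  - exact: nnmeasR_test.
  - by apply: nnmeasR_mul => //; exact/nnmeasR_cst/expR_ge0.
  move=> X; rewrite PiE -expRD; case: (boolP (b X)) => [/hb h|_] /=; last exact: expR_ge0.
  by rewrite -expR0 ler_expR addrC subr_ge0.
rewrite espZ ?expR_ge0// ePi -EFinM lee_fin addrC expRD ler_wpM2l ?expR_ge0//.
rewrite mulr_sumr expR_sum; apply: ler_prod => j _.
have q0 := prob_ge0 th (mexc j); have q1 := prob_le1 th (mexc j).
apply/andP; split; first by rewrite addr_ge0 ?subr_ge0// mulr_ge0 ?expR_ge0.
by apply: le_trans (expR_ge1Dx _); lra.
Qed.

(** A constant row is orthogonal to [w], so the whole null hypothesis behaves like theta = 0. *)
Lemma Theta0_exceeds th j : th \in @Theta0 R p n -> prob th (exc j) = prob 0 (exc j).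
Proof.
rewrite inE => th0; rewrite exceeds_shift ?dot_row_row// dot_row.
rewrite (_ : \sum_i _ = 0) ?scale0r//.
(* The constant value of a row is read off in column 0, which requires n > 0. *)
case: n th th0 w w0 => [|n'] th' th0' w' w0'; first by rewrite big_ord0.
by under eq_bigr do rewrite (th0' j _ ord0); rewrite -mulr_suml w0' mul0r.
Qed.

End counting.

(** * Counting and maximum tests over a family of contrasts *)

Section scan.
Variables (T : eqType) (G : seq T) (w : T -> 'I_n -> R) (tau mu0 : R).
Hypothesis w1 : forall t, t \in G -> \sum_i w t i ^+ 2 = 1.
Hypothesis w0 : forall t, t \in G -> \sum_i w t i = 0.
Hypotheses (tau0 : 0 <= tau) (mu0tau : mu0 <= tau).

Let exc t j := exceeds tau (row_mx_of j (w t)).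

Let mexc t j : measurable_test (exc t j). Proof. exact: measurable_exceeds. Qed.

Let q t := \sum_j prob 0 (exc t j).

Let q_le t : t \in G -> q t <= p%:R * tail_bound tau.
Proof.
move=> tG; apply: (@le_trans _ _ (\sum_(j < p) tail_bound tau)).
  by apply: ler_sum => j _; rewrite exceeds_tail// dot_row_row w1.
by rewrite sumr_const card_ord mulr_natl.
Qed.

Let q_ge0 t : 0 <= q t.
Proof. by apply: sumr_ge0 => j _; exact: prob_ge0. Qed.

Section count_test.
Variable s : nat.
Hypothesis s0 : (0 < s)%N.
Hypothesis tail_power : 2 * tail_bound tau <= power_bound tau mu0.

(** Guaranteed excess of the mean count: by [tail_power], each of s signal rows gains at least half
    of [power_bound]. The test cuts midway, at [D / 2]. *)
Let D := s%:R * (power_bound tau mu0 / 2).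

Let D0 : 0 < D.
Proof. by rewrite mulr_gt0 ?ltr0n// divr_gt0// divr_gt0// expR_gt0. Qed.

Let m := p%:R * tail_bound tau.

Let m0 : 0 <= m.
Proof. by rewrite mulr_ge0// mulr_ge0// expR_ge0. Qed.

Definition count_error : R := expR (- (D ^+ 2 / (32 * (m + D)))).

(* Chernoff parameter, balancing both types of error. *)
Let lam := D / (8 * (m + D)).

(** [lam] minimizes -lam D/2 + 2 lam^2 (m + D), the exponent in both error bounds. It is at most 1/8
    because D <= m + D. *)
Let lam_props : [/\ 0 < lam, lam <= 1 / 8 &
  - (lam * (D / 2)) + 2 * lam ^+ 2 * (m + D) = - (D ^+ 2 / (32 * (m + D)))].
Proof.
have mD : 0 < m + D by rewrite ltr_wpDl.
split; first by rewrite divr_gt0// mulr_gt0.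
  have h (x y : R) : 0 <= x -> y <= 1 / 8 * (8 * (x + y)) by lra.
  by rewrite ler_pdivrMr ?mulr_gt0//; exact: h.
by rewrite /lam; field; rewrite gt_eqF.
Qed.

Definition count_test X := has (fun t => q t + D / 2 <= exceed_count tau (w t) X) G.

Let mtest t : measurable_test (fun X => q t + D / 2 <= exceed_count tau (w t) X).
Proof.
apply: measurable_fun_test; apply: measurable_fun_ler => //.
exact: measurable_exceed_count.
Qed.

Lemma measurable_count_test : measurable_test count_test.
Proof. exact: measurable_test_has. Qed.

Lemma count_test_null th : th \in @Theta0 R p n ->
  prob th count_test <= (size G)%:R * count_error.
Proof.
move=> th0; apply: prob_has => // t tG.
have [l0 l8 le] := lam_props.
apply: le_trans (@chernoff tau (w t) th lam (lam * (q t + D / 2)) _ (mtest t) _) _.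
  by move=> X h; rewrite ler_pM2l.
rewrite ler_expR -le.
under eq_bigr do rewrite (Theta0_exceeds tau (w1 tG) (w0 tG) _ th0).
rewrite -/(q t).
have H1 : (expR lam - 1) * q t <= (lam + 2 * lam ^+ 2) * q t.
  have h (x l : R) : x <= 1 + l + 2 * l ^+ 2 -> x - 1 <= l + 2 * l ^+ 2 by lra.
  by rewrite ler_wpM2r// h// expR_quadratic// (le_trans l8)//; lra.
have H2 : 2 * lam ^+ 2 * q t <= 2 * lam ^+ 2 * (m + D).
  apply: ler_wpM2l; first by rewrite mulr_ge0 ?sqr_ge0.
  by apply: le_trans (q_le tG) _; rewrite lerDl ltW.
have h (x y z l d : R) : (y - 1) * x <= (l + 2 * l ^+ 2) * x ->
  2 * l ^+ 2 * x <= 2 * l ^+ 2 * z ->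
  (y - 1) * x - l * (x + d / 2) <= - (l * (d / 2)) + 2 * l ^+ 2 * z by lra.
exact: h.
Qed.

Lemma count_test_power th t (S : {set 'I_p}) : t \in G -> (s <= #|S|)%N ->
  (forall j, j \in S -> mu0 <= \sum_i w t i * th j i) ->
  prob th (fun X => ~~ count_test X) <= count_error.
Proof.
move=> tG sS hS; have [l0 l8 le] := lam_props.
have pE j : prob th (exc t j) =
    prob (dot (row_mx_of j (w t)) th *: row_mx_of j (w t)) (exc t j).
  by rewrite exceeds_shift// dot_row_row w1.
have Psum : q t + D <= \sum_j prob th (exc t j).
  rewrite -lerBrDl -sumrB (bigID (fun j => j \in S))/= ler_wpDr//.
    apply: sumr_ge0 => j _; rewrite subr_ge0 pE exceeds_increases//.
    by rewrite dot_row_row w1.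
  apply: (@le_trans _ _ (\sum_(j in S) (power_bound tau mu0 / 2))).
    rewrite sumr_const -[leRHS]mulr_natl ler_wpM2r ?ler_nat//.
    by rewrite !divr_ge0// expR_ge0.
  apply: ler_sum => j jS.
  have H1 : power_bound tau mu0 <= prob th (exc t j).
    by rewrite pE exceeds_power// ?dot_row_row ?w1// dot_row hS.
  have H2 : prob 0 (exc t j) <= tail_bound tau.
    by rewrite exceeds_tail// dot_row_row w1.
  have h (x y z d : R) : 2 * z <= x -> x <= y -> d <= z -> x / 2 <= y - d by lra.
  exact: h tail_power H1 H2.
apply: le_trans (@chernoff tau (w t) th (- lam) (- (lam * (q t + D / 2))) _ _ _) _.
- exact: measurable_testN measurable_count_test.
- move=> X /hasPn/(_ t tG); rewrite -ltNge => /ltW h.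
  by rewrite mulNr lerN2 ler_pM2l.
rewrite ler_expR -le.
set P := \sum_j _ in Psum *.
have P0 : 0 <= P by apply: sumr_ge0 => j _; exact: prob_ge0.
have H1 : (expR (- lam) - 1) * P <= (- lam + 2 * lam ^+ 2) * P.
  have h (x l : R) : x <= 1 - l + 2 * l ^+ 2 -> x - 1 <= - l + 2 * l ^+ 2 by lra.
  rewrite ler_wpM2r// h// -[lam ^+ 2]sqrrN expR_quadratic//.
  by rewrite (@le_trans _ _ 0) ?oppr_le0 ?(ltW l0)//; lra.
(* The rows outside [S] may make P as large as p, so P is not bounded above. Since lam <= 1/8 its
   total coefficient is nonpositive, and P can be lowered to q + D. *)
have H2 : (lam - 2 * lam ^+ 2) * (q t + D) <= (lam - 2 * lam ^+ 2) * P.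
  have h (l : R) : 0 < l -> l <= 1 / 8 -> 0 <= l - 2 * l ^+ 2 by nra.
  by rewrite ler_wpM2l//; exact: h.
have H3 : 2 * lam ^+ 2 * (q t + D) <= 2 * lam ^+ 2 * (m + D).
  by apply: ler_wpM2l; [rewrite mulr_ge0 ?sqr_ge0|rewrite lerD2r q_le].
have h (x y z d l P' : R) : (y - 1) * P' <= (- l + 2 * l ^+ 2) * P' ->
  (l - 2 * l ^+ 2) * (x + d) <= (l - 2 * l ^+ 2) * P' ->
  2 * l ^+ 2 * (x + d) <= 2 * l ^+ 2 * (z + d) ->
  (y - 1) * P' - - (l * (x + d / 2)) <= - (l * (d / 2)) + 2 * l ^+ 2 * (z + d) by lra.
exact: h.
Qed.

End count_test.

Definition max_test X := has (fun t => has (fun j => exc t j X) (enum 'I_p)) G.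

Lemma measurable_max_test : measurable_test max_test.
Proof. by apply: measurable_test_has => t; exact: measurable_test_has. Qed.

Lemma max_test_null th : th \in @Theta0 R p n ->
  prob th max_test <= (size G)%:R * (p%:R * tail_bound tau).
Proof.
move=> th0; apply: prob_has => [t|t tG]; first exact: measurable_test_has.
rewrite -[X in X%:R * _]size_enum_ord; apply: prob_has => // j _.
rewrite (Theta0_exceeds tau (w1 tG) (w0 tG) _ th0) exceeds_tail//.
by rewrite dot_row_row w1.
Qed.

Lemma max_test_power th t j mu : t \in G -> tau <= mu ->
  mu <= \sum_i w t i * th j i ->
  prob th (fun X => ~~ max_test X) <= expR (- ((mu - tau) ^+ 2 / 2)).
Proof.
move=> tG tm hmu.
have mN := measurable_testN (mexc t j).
apply: (@le_trans _ _ (prob th (fun X => ~~ exc t j X))).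
  rewrite -lee_fin -!esp_prob//; last exact: measurable_testN measurable_max_test.
  apply: esp_le; [exact: nnmeasR_test (measurable_testN measurable_max_test)
    |exact: nnmeasR_test|].
  move=> X; rewrite ler_nat; case: (boolP (max_test X)) => //= nX.
  suff -> : exc t j X = false by [].
  apply/negbTE; apply: contra nX => eX.
  by apply/hasP; exists t => //; apply/hasP; exists j; rewrite ?mem_enum.
have v1 : dot (row_mx_of j (w t)) (row_mx_of j (w t)) = 1 by rewrite dot_row_row w1.
rewrite (probN th (mexc t j)) (exceeds_shift _ _ v1) -(probN _ (mexc t j)).
apply: le_trans (exceeds_miss v1 _) _; first by rewrite dot_row (le_trans tm).
by rewrite dot_row ler_expR; nra.
Qed.

End scan.

End tests.

(** * Step functions and the minimax risk *)

Section risk.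
Context {R : realType} {p n : nat}.
Local Notation M := 'M[R]_(p, n).
Implicit Types (psi : M -> bool).

Lemma risk_le rho s psi (a b : R) : measurable_test psi ->
  (forall th, th \in @Theta0 R p n -> prob th psi <= a) ->
  (forall th, th \in @Theta1_1side R p n rho s -> prob th (fun X => ~~ psi X) <= b) ->
  (risk_1side p n rho s <= (a + b)%:E)%E.
Proof.
move=> mpsi ha hb; apply: ge_ereal_inf; eexists; first by exists psi; split.
rewrite EFinD; apply: leeD; apply: ge_ereal_sup => _ [th thT <-].
  by have := ha th (mem_set thT); rewrite -lee_fin -esp_prob.
have := hb th (mem_set thT).
by rewrite -lee_fin -esp_prob//; exact: measurable_testN.
Qed.

(** A nonempty alternative keeps the second supremum away from -oo, so it is a real number and can
    be taken as [B]. The null is represented by theta = 0. *)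
Lemma risk_ge rho s (c : R) : @Theta1_1side R p n rho s !=set0 ->
  (forall psi (B : R), measurable_test psi ->
     (forall th, th \in @Theta1_1side R p n rho s ->
        (esp th (fun X => (~~ psi X)%:R) <= B%:E)%E) ->
     (c%:E <= esp 0 (fun X => (psi X)%:R) + B%:E)%E) ->
  (c%:E <= risk_1side p n rho s)%E.
Proof.
move=> [th1 th1T] hc; apply: le_ereal_inf_tmp => _ [psi [mpsi ->]].
set S1 := ereal_sup [set Etheta th _ | th in Theta1_1side _ _].
have S1_ub th : th \in @Theta1_1side R p n rho s ->
    (esp th (fun X => (~~ psi X)%:R) <= S1)%E.
  by rewrite inE => thT; apply: ereal_sup_ubound; exists th.
have S1_le : (S1 <= 1)%E.
  by apply: ge_ereal_sup => _ [th _ <-]; exact: (esp_test_le1 th (measurable_testN mpsi)).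
have S1_ge : (0 <= S1)%E.
  by apply: le_trans (S1_ub _ (mem_set th1T));
    exact: esp_ge0 (nnmeasR_test (measurable_testN mpsi)).
have S1_fin : S1 \is a fin_num by rewrite ge0_fin_numE// (le_lt_trans S1_le) ?ltry.
apply: le_trans (hc psi (fine S1) mpsi _) _; first by move=> th /S1_ub; rewrite fineK.
rewrite fineK//; apply: leeD => //; apply: ereal_sup_ubound; exists 0 => //.
by move=> j i i'; rewrite !mxE.
Qed.

End risk.

(** * CUSUM contrasts and the cost of a misplaced change point *)

Section cusum.
Context {R : realType} (n : nat).

Lemma sum_step (t : nat) (a b : R) : (t <= n)%N ->
  \sum_(i < n) (if (i < t)%N then a else b) = t%:R * a + (n - t)%:R * b.
Proof.
move=> tn; rewrite -(big_mkord xpredT (fun i => if (i < t)%N then a else b)).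
rewrite (big_cat_nat (n := t))//=; congr (_ + _).
  under eq_big_nat => i /andP[_ it] do rewrite it.
  by rewrite sumr_const_nat subn0 mulr_natl.
under eq_big_nat => i /andP[ti _] do rewrite ltnNge ti /=.
by rewrite sumr_const_nat mulr_natl.
Qed.

Definition cusum_scale (t : nat) : R := Num.sqrt ((t * (n - t))%:R / n%:R).

(* Unit vector orthogonal to the constants, jumping at [t]. *)
Definition cusum (t : nat) (i : 'I_n) : R :=
  if (i < t)%N then cusum_scale t / t%:R else - (cusum_scale t / (n - t)%:R).

Variable t : nat.
Hypotheses (t0 : (0 < t)%N) (tn : (t < n)%N).

Let tR : 0 < t%:R :> R. Proof. by rewrite ltr0n. Qed.
Let ntR : 0 < (n - t)%:R :> R. Proof. by rewrite ltr0n subn_gt0. Qed.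
Let nR : 0 < n%:R :> R. Proof. by rewrite ltr0n (leq_trans _ tn). Qed.
Let ntE : n%:R = t%:R + (n - t)%:R :> R. Proof. by rewrite -natrD subnKC// ltnW. Qed.

Lemma cusum_scale_gt0 : 0 < cusum_scale t.
Proof. by rewrite sqrtr_gt0 divr_gt0// natrM mulr_gt0. Qed.

Lemma cusum_scale_sqr : cusum_scale t ^+ 2 = t%:R * (n - t)%:R / n%:R.
Proof. by rewrite sqr_sqrtr ?natrM// divr_ge0// mulr_ge0// ltW. Qed.

Lemma cusum_sum0 : \sum_i cusum t i = 0.
Proof.
rewrite sum_step ?(ltnW tn)// mulrN mulrCA divff ?gt_eqF// mulrCA divff ?gt_eqF//.
by rewrite subrr.
Qed.

Lemma cusum_norm1 : \sum_i cusum t i ^+ 2 = 1.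
Proof.
transitivity (\sum_(i < n) (if (i < t)%N then (cusum_scale t / t%:R) ^+ 2
    else (cusum_scale t / (n - t)%:R) ^+ 2)).
  by apply: eq_bigr => i _; rewrite /cusum; case: ifP => // _; rewrite sqrrN.
rewrite sum_step ?(ltnW tn)// !exprMn cusum_scale_sqr ntE; field.
by rewrite -ntE !gt_eqF.
Qed.

Lemma cusum_step (u : nat) (m1 m2 : R) : (u <= n)%N ->
  \sum_i cusum t i * (if (i < u)%N then m1 else m2) =
  (m1 - m2) * cusum_scale t *
    (if (t <= u)%N then (n - u)%:R / (n - t)%:R else u%:R / t%:R).
Proof.
move=> un.
(* Orthogonality to constants removes the level [m2]. *)
have -> : \sum_i cusum t i * (if (i < u)%N then m1 else m2) =
    (m1 - m2) * \sum_(i < n) (if (i < u)%N then cusum t i else 0).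
  transitivity (\sum_(i < n) ((m1 - m2) * (if (i < u)%N then cusum t i else 0) + m2 * cusum t i)).
    by apply: eq_bigr => i _; case: ifP => _; ring.
  by rewrite big_split/= -!mulr_sumr cusum_sum0 mulr0 addr0.
rewrite -mulrA; congr (_ * _); have [tu|ut] := leqP t u.
  transitivity (\sum_(i < n) ((if (i < u)%N then - (cusum_scale t / (n - t)%:R) else 0) +
     (if (i < t)%N then cusum_scale t / t%:R + cusum_scale t / (n - t)%:R else 0))).
    apply: eq_bigr => i _; rewrite /cusum; case: (ltnP i t) => it.
      by rewrite (leq_trans it tu) addrC addrK.
    by rewrite addr0.
  rewrite big_split/= !sum_step// ?(leq_trans tu)// (natrB _ un).
  rewrite !mulr0 !addr0 ntE; field.
  by rewrite !gt_eqF.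
transitivity (\sum_(i < n) (if (i < u)%N then cusum_scale t / t%:R else 0)).
  by apply: eq_bigr => i _; rewrite /cusum; case: (ltnP i u) => // iu; rewrite (ltn_trans iu ut).
rewrite sum_step// mulr0 addr0; ring.
Qed.

(** For t <= u the squared correlation of the two contrasts is (t/u)((n-u)/(n-t)), a product of two
    ratios that are each at least d; for u <= t the roles are exchanged. *)
Lemma cusum_detect (u : nat) (m1 m2 d rho : R) : (0 < u)%N -> (u < n)%N ->
  0 <= rho -> 0 <= d ->
  rho <= cusum_scale u * (m1 - m2) ->
  ((t <= u)%N /\ d * u%:R <= t%:R /\ d * (n - t)%:R <= (n - u)%:R) \/
  ((u <= t)%N /\ d * t%:R <= u%:R /\ d * (n - u)%:R <= (n - t)%:R) ->
  d * rho <= \sum_i cusum t i * (if (i < u)%N then m1 else m2).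
Proof.
move=> u0 un r0 d0 hrho hd; rewrite cusum_step ?(ltnW un)//.
have uR : 0 < u%:R :> R by rewrite ltr0n.
have nuR : 0 < (n - u)%:R :> R by rewrite ltr0n subn_gt0.
have su2 : cusum_scale u ^+ 2 = u%:R * (n - u)%:R / n%:R.
  by rewrite sqr_sqrtr ?natrM// divr_ge0// mulr_ge0// ltW.
have su0 : 0 < cusum_scale u by rewrite sqrtr_gt0 divr_gt0// natrM mulr_gt0.
have st0 := cusum_scale_gt0; have st2 := cusum_scale_sqr.
have m0 : 0 <= m1 - m2 by rewrite -(pmulr_rge0 _ su0) (le_trans r0).
suff H : d * cusum_scale u <= cusum_scale t *
    (if (t <= u)%N then (n - u)%:R / (n - t)%:R else u%:R / t%:R).
  apply: le_trans (ler_wpM2l d0 hrho) _.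
  rewrite (_ : d * _ = (m1 - m2) * (d * cusum_scale u)); last by ring.
  by rewrite -mulrA ler_wpM2l.
have arith (x y z w : R) : 0 < x -> 0 < y -> 0 < z -> 0 < w ->
    d * x <= y -> d * w <= z ->
    d ^+ 2 * (x * z) <= y * w * (z / w) ^+ 2.
  move=> x0 y0 z0 w0 h1 h2.
  have -> : y * w * (z / w) ^+ 2 = y * z * (z / w).
    by field; rewrite gt_eqF.
  have h3 : d <= z / w by rewrite ler_pdivlMr.
  have h4 : d * (x * z) <= y * z by rewrite mulrA ler_wpM2r// ltW.
  rewrite expr2 -mulrA [leRHS]mulrC.
  apply: ler_pM => //; first by rewrite mulr_ge0// mulr_ge0// ltW.
have E1 : (d * cusum_scale u) ^+ 2 = d ^+ 2 * (u%:R * (n - u)%:R) / n%:R.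
  by rewrite exprMn su2; ring.
have E2 x : (cusum_scale t * x) ^+ 2 = t%:R * (n - t)%:R * x ^+ 2 / n%:R.
  by rewrite exprMn st2; ring.
case: hd => [[tu [h1 h2]]|[ut [h1 h2]]].
  rewrite tu -ler_sqr ?nnegrE; last 2 first.
  - by rewrite mulr_ge0// ltW.
  - by rewrite mulr_ge0 ?(ltW st0)// divr_ge0// ltW.
  by rewrite E1 E2 ler_pM2r ?invr_gt0//; exact: arith.
have -> : (if (t <= u)%N then (n - u)%:R / (n - t)%:R else u%:R / t%:R) = u%:R / t%:R :> R.
  case: leqP => // tu; have -> : u = t by apply/eqP; rewrite eqn_leq ut tu.
  by rewrite !divff ?gt_eqF.
rewrite -ler_sqr ?nnegrE; last 2 first.
- by rewrite mulr_ge0// ltW.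
- by rewrite mulr_ge0 ?(ltW st0)// divr_ge0// ltW.
rewrite E1 E2 ler_pM2r ?invr_gt0// [u%:R * _]mulrC [t%:R * _]mulrC.
exact: arith.
Qed.

End cusum.

(** * Dyadic grid of change points *)

Section grid.
Local Open Scope nat_scope.
Variables (n B : nat).

(* Contains every [m <= n] with all but its leading [B + 1] binary digits set to 0. *)
Definition dyadic_grid : seq nat :=
  [seq c * 2 ^ k | c <- iota 1 (2 ^ B.+1), k <- iota 0 (trunc_log 2 n).+1].

(** The reflected copy gives relative precision in n - t near the right end. *)
Definition scan_grid : seq nat :=
  [seq t <- dyadic_grid ++ [seq n - h | h <- dyadic_grid] | 0 < t < n]%N.

Lemma size_scan_grid : (size scan_grid <= 2 ^ B.+2 * (trunc_log 2 n).+1)%N.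
Proof.
rewrite size_filter (leq_trans (count_size _ _))// size_cat size_map /dyadic_grid.
by rewrite size_allpairs !size_iota addnn -mul2n mulnA -expnS.
Qed.

Lemma dyadic_gridP (m : nat) : (0 < m)%N -> (m <= n)%N ->
  exists h, [/\ h \in dyadic_grid, (0 < h)%N, (h <= m)%N & (2 ^ B * (m - h) <= m)%N].
Proof.
move=> m0 mn; pose l := trunc_log 2 m; pose k := (l - B)%N.
(* Clearing the lowest k bits of m loses less than 2^k, while m >= 2^(k+B). For l <= B the truncated
   subtraction gives k = 0 and m itself is in the grid. *)
have l1 : (2 ^ l <= m)%N by exact: trunc_logP.
have l2 : (m < 2 ^ l.+1)%N by exact: trunc_log_ltn.
have kl : (2 ^ k <= m)%N by rewrite (leq_trans _ l1)// leq_exp2l// leq_subr.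
have k0 : (0 < 2 ^ k)%N by rewrite expn_gt0.
have c0 : (0 < m %/ 2 ^ k)%N by rewrite divn_gt0.
exists (m %/ 2 ^ k * 2 ^ k)%N; split.
- apply: allpairs_f; rewrite mem_iota.
    rewrite c0 /= add1n ltnS -ltnS (leq_trans (n := (2 ^ B.+1).+1))// ltnS.
    rewrite -ltnS ltn_divLR//.
    apply: leq_trans l2 _; rewrite mulSn -expnD (leq_trans _ (leq_addl _ _))//.
    by rewrite leq_exp2l// addSn ltnS -leq_subLR.
  rewrite add0n /= ltnS (leq_trans (leq_subr _ _))//.
  by apply: leq_trunc_log.
- by rewrite muln_gt0 c0.
- exact: leq_trunc_div.
- have -> : (m - m %/ 2 ^ k * 2 ^ k = m %% 2 ^ k)%N.
    by rewrite {1}(divn_eq m (2 ^ k)) addKn.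
  have [lB|Bl] := leqP l B.
    by rewrite /k (eqP (_ : (l - B)%N == 0%N)) ?subn_eq0// expn0 modn1 muln0.
  apply: leq_trans l1; rewrite -(subnKC (ltnW Bl)) -/k expnD leq_mul2l.
  by rewrite (ltnW (ltn_pmod _ _)) ?orbT.
Qed.

End grid.

(** * Risk bounds for the two scan tests *)

Section upper_risk.
Context {R : realType} (p n s B : nat).

(** The fraction of the signal that survives discretization, tending to 1 as [B] grows. *)
Definition grid_loss : R := 1 - (2 ^ B)%:R^-1.

Lemma grid_loss_ge0 : 0 <= grid_loss.
Proof. by rewrite subr_ge0 invf_le1 ?ler1n ?ltr0n ?expn_gt0. Qed.

Lemma scan_gridP (u : nat) : (0 < u)%N -> (u < n)%N ->
  exists2 t, t \in scan_grid n B &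
  ((t <= u)%N /\ grid_loss * u%:R <= t%:R /\ grid_loss * (n - t)%:R <= (n - u)%:R) \/
  ((u <= t)%N /\ grid_loss * t%:R <= u%:R /\ grid_loss * (n - u)%:R <= (n - t)%:R).
Proof.
move=> u0 un.
have B0 : 0 < (2 ^ B)%:R :> R by rewrite ltr0n expn_gt0.
have aux (x y : nat) : (y <= x)%N -> (2 ^ B * (x - y) <= x)%N -> grid_loss * x%:R <= y%:R.
  move=> yx h; rewrite /grid_loss mulrBl mul1r lerBlDr -lerBlDl -natrB//.
  by rewrite mulrC ler_pdivlMr// -natrM ler_nat mulnC.
(* The distance to the nearer end is rounded. The rounding error is small relative to that distance,
   hence also relative to the distance to the farther end. *)
have [un2|nu2] := leqP u (n - u).
  have [h [hG h0 hu hb]] := @dyadic_gridP n B u u0 (ltnW un).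
  exists h; first by rewrite mem_filter h0 (leq_ltn_trans hu un) mem_cat hG.
  left; split => //; split; first exact: aux.
  apply: aux; first by rewrite leq_sub2l.
  have -> : (n - h - (n - u) = u - h)%N by lia.
  by rewrite (leq_trans hb)// (leq_trans un2)// leq_sub2l.
have nu0 : (0 < n - u)%N by rewrite subn_gt0.
have [h [hG h0 hu hb]] := @dyadic_gridP n B (n - u) nu0 (leq_subr _ _).
exists (n - h)%N.
  rewrite mem_filter mem_cat; apply/andP; split; first by lia.
  by apply/orP; right; exact: map_f.
right; split; first by lia.
have nhh : (n - (n - h) = h)%N by lia.
split; last by rewrite nhh; exact: aux.
apply: aux; first by lia.
have -> : (n - h - u = n - u - h)%N by lia.
by rewrite (leq_trans hb)//; lia.
Qed.

Definition grid_size : nat := 2 ^ B.+2 * (trunc_log 2 n).+1.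

Let scan1 t : t \in scan_grid n B -> \sum_i @cusum R n t i ^+ 2 = 1.
Proof. by rewrite mem_filter => /andP[/andP[t0 tn] _]; exact: cusum_norm1. Qed.

Let scan0 t : t \in scan_grid n B -> \sum_i @cusum R n t i = 0.
Proof. by rewrite mem_filter => /andP[/andP[t0 tn] _]; exact: cusum_sum0. Qed.

Lemma Theta1_detect (rho : R) th : 0 <= rho -> th \in @Theta1_1side R p n rho s ->
  exists2 t, t \in scan_grid n B & exists2 S : {set 'I_p}, (s <= #|S|)%N &
    forall j, j \in S -> grid_loss * rho <= \sum_i cusum t i * th j i.
Proof.
move=> r0; rewrite inE => -[u [mu1 [mu2 [S [u0 un sS thE hS]]]]].
have un' : (u < n)%N by lia.
have [t tG ht] := scan_gridP u0 un'; exists t => //; exists S => // j jS.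
have := tG; rewrite mem_filter => /andP[/andP[t0 tn] _].
under eq_bigr do rewrite thE.
by apply: (@cusum_detect R n t t0 tn u) => //; [exact: grid_loss_ge0|exact: hS].
Qed.

Lemma risk_count_le (tau mu0 rho : R) : 0 <= tau -> mu0 <= tau -> (0 < s)%N ->
  2 * tail_bound tau <= power_bound tau mu0 -> 0 <= rho -> mu0 <= grid_loss * rho ->
  (risk_1side p n rho s <=
    (grid_size%:R * @count_error R p tau mu0 s + @count_error R p tau mu0 s)%:E)%E.
Proof.
move=> tau0 mt s0 tp r0 mr.
pose w t := @cusum R n t.
have m := @measurable_count_test R p n _ (scan_grid n B) w tau mu0 s.
apply: (risk_le m) => th hth.
  apply: (le_trans (count_test_null mu0 scan1 scan0 tau0 s0 hth)).
  by rewrite ler_wpM2r ?expR_ge0// ler_nat size_scan_grid.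
have [t tG [S sS hS]] := Theta1_detect r0 hth.
apply: (count_test_power scan1 tau0 mt s0 tp tG sS) => j jS.
exact: le_trans mr (hS _ jS).
Qed.

Lemma risk_max_le (tau rho : R) : 0 <= tau -> tau <= grid_loss * rho -> (0 < s)%N ->
  0 <= rho ->
  (risk_1side p n rho s <= (grid_size%:R * (p%:R * tail_bound tau) +
     expR (- ((grid_loss * rho - tau) ^+ 2 / 2)))%:E)%E.
Proof.
move=> tau0 mr s0 r0.
pose w t := @cusum R n t.
have m := @measurable_max_test R p n _ (scan_grid n B) w tau.
apply: (risk_le m) => th hth.
  apply: (le_trans (max_test_null scan1 scan0 tau0 hth)).
  by rewrite ler_wpM2r ?mulr_ge0 ?expR_ge0// ler_nat size_scan_grid.
have [t tG [S sS hS]] := Theta1_detect r0 hth.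
have /card_gt0P[j jS] := leq_trans s0 sS.
exact: (max_test_power scan1 tG mr (hS j jS)).
Qed.

End upper_risk.

(** * Prior on step functions with geometrically spaced change points *)

Section lower_risk.
Context {R : realType} (p n s m L q : nat) (rho u eta : R).
Hypotheses (s0 : (0 < s)%N) (m0 : (0 < m)%N) (L0 : (0 < L)%N).
Hypothesis smp : (s * m <= p)%N.
Hypotheses (q1 : (1 < q)%N) (qLn : ((q ^ 2) ^ L <= n)%N).
(* All rows share one change point, so several blocks allow only one choice of it. *)
Hypothesis sL : s = 1%N \/ L = 1%N.
Hypotheses (rho0 : 0 <= rho) (u0 : 0 < u) (u1 : u <= 1) (eta0 : 0 <= eta).

(** The ratio is q^2 because two atoms in one row have correlation sqrt(t/t'), which is then at most
    1/q. *)
Let t k : nat := (q ^ 2) ^ k.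

(** An atom has level 0 after its change point, so its squared norm is rho^2 n/(n-t), and q^2 t <= n
    bounds the last factor. *)
Definition prior_norm : R := rho ^+ 2 / (1 - (q ^ 2)%:R^-1).

Hypothesis eta_ge : (1 < L)%N -> prior_norm / q%:R <= eta.

Let mu k : R := rho / cusum_scale n (t k).

Let t_gt0 k : (0 < t k)%N.
Proof. by rewrite /t expn_gt0 expn_gt0 (ltnW q1). Qed.

Let q2 : (1 < q ^ 2)%N.
Proof. by rewrite -(exp1n 2) ltn_exp2r. Qed.

Let t_le k : (k < L)%N -> (q ^ 2 * t k <= n)%N.
Proof.
by move=> kL; rewrite -expnS (leq_trans _ qLn)// leq_exp2l.
Qed.

Let t_lt k : (k < L)%N -> (t k < n)%N.
Proof. by move=> /t_le; apply: leq_trans; rewrite ltn_Pmull. Qed.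

Let scale_gt0 k : (k < L)%N -> 0 < cusum_scale n (t k) :> R.
Proof. by move=> kL; apply: cusum_scale_gt0 => //; exact: t_lt. Qed.

Let mu_ge0 k : 0 <= mu k.
Proof. by rewrite divr_ge0// sqrtr_ge0. Qed.

Let tau0 : 0 < 1 - (q ^ 2)%:R^-1 :> R.
Proof. by rewrite subr_gt0 invf_lt1 ?ltr1n ?ltr0n// (ltnW q2). Qed.

Let norm_ge0 : 0 <= prior_norm.
Proof. by rewrite divr_ge0 ?sqr_ge0// ltW. Qed.

Let t_mu k : (k < L)%N -> (t k)%:R * mu k ^+ 2 <= prior_norm.
Proof.
move=> kL; have tn := t_lt kL.
rewrite /mu /prior_norm expr_div_n cusum_scale_sqr//.
have t0 : 0 < (t k)%:R :> R by rewrite ltr0n.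
have n0 : 0 < n%:R :> R by rewrite ltr0n (leq_trans _ tn).
have nt0 : 0 < (n - t k)%:R :> R by rewrite ltr0n subn_gt0.
rewrite (_ : _ * _ = rho ^+ 2 * (n%:R / (n - t k)%:R)); last first.
  by field; rewrite !gt_eqF.
rewrite ler_wpM2l ?sqr_ge0// ler_pdivrMr// ler_pdivlMl//.
rewrite mulrBl mul1r (natrB _ (ltnW tn)) lerB// ler_pdivlMl ?ltr0n ?(ltnW q2)//.
by rewrite -natrM ler_nat; exact: t_le.
Qed.

Lemma row_of_subproof (b : 'I_s) (i : 'I_m) : (b * m + i < p)%N.
Proof.
apply: leq_trans smp; apply: (@leq_trans (b * m + m)); first by rewrite ltn_add2l.
by rewrite addnC -mulSn leq_mul2r (ltn_ord b) orbT.
Qed.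

Let row_of b i : 'I_p := Ordinal (row_of_subproof b i).

Let K : finType := ('I_m * 'I_L)%type.

Let v (b : 'I_s) (x : K) : 'M[R]_(p, n) :=
  row_mx_of (row_of b x.1) (fun c : 'I_n => if (c < t x.2)%N then mu x.2 else 0).

Let dot_v b (x y : K) : (x.2 <= y.2)%N ->
  dot (v b x) (v b y) = if x.1 == y.1 then (t x.2)%:R * (mu x.2 * mu y.2) else 0.
Proof.
move=> xy; rewrite /v dot_row.
have E : (row_of b x.1 == row_of b y.1) = (x.1 == y.1).
  by rewrite -val_eqE /= eqn_add2l val_eqE.
under eq_bigr do rewrite mxE E.
case: eqP => _; last by apply: big1 => i _; rewrite mulr0.
transitivity (\sum_(c < n) (if (c < t x.2)%N then mu x.2 * mu y.2 else 0)).
  apply: eq_bigr => c _; case: ltnP => cx; last by rewrite mul0r.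
  by rewrite (leq_trans cx)// leq_exp2l.
by rewrite sum_step ?mulr0 ?addr0// ltnW// t_lt.
Qed.

Let v_norm b x : dot (v b x) (v b x) <= prior_norm.
Proof. by rewrite dot_v// eqxx -expr2 t_mu. Qed.

Let v_cross_lt b (x y : K) : (x.2 < y.2)%N -> dot (v b x) (v b y) <= eta.
Proof.
move=> xy; rewrite dot_v ?(ltnW xy)//; case: eqP => // _.
have L1 : (1 < L)%N by rewrite (leq_ltn_trans _ (ltn_ord y.2))// (leq_trans _ xy).
have qR : 0 < q%:R :> R by rewrite ltr0n ltnW.
apply: le_trans (eta_ge L1).
have mm : 0 <= (t x.2)%:R * (mu x.2 * mu y.2).
  exact: mulr_ge0 (ler0n _ _) (mulr_ge0 (mu_ge0 _) (mu_ge0 _)).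
rewrite -ler_sqr ?nnegrE//; last exact: divr_ge0 norm_ge0 (ltW qR).
have tx : 0 < (t x.2)%:R :> R by rewrite ltr0n.
have ty : 0 < (t y.2)%:R :> R by rewrite ltr0n.
rewrite (_ : _ ^+ 2 = ((t x.2)%:R * mu x.2 ^+ 2) * ((t y.2)%:R * mu y.2 ^+ 2) *
   ((t x.2)%:R / (t y.2)%:R)); last by field; rewrite gt_eqF.
rewrite [leRHS]expr_div_n [prior_norm ^+ 2]expr2.
have tmx k : 0 <= (t k)%:R * mu k ^+ 2 by rewrite mulr_ge0 ?sqr_ge0.
apply: ler_pM; first by rewrite mulr_ge0.
- by rewrite divr_ge0// ltW.
- by apply: ler_pM => //; exact: t_mu.
rewrite ler_pdivrMr// mulrC ler_pdivlMr ?exprn_gt0// -natrX -natrM ler_nat.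
by rewrite mulnC -expnS leq_exp2l.
Qed.

Let v_cross b (x y : K) : x != y -> dot (v b x) (v b y) <= eta.
Proof.
move=> xy; have [l|l|e] := ltngtP x.2 y.2; [exact: v_cross_lt|by rewrite dotC v_cross_lt|].
rewrite dot_v ?e//; case: eqP => // e1; exfalso; move: xy; apply/negP/negPn/eqP.
by move: x y e e1 => [x1 x2] [y1 y2] /= e ->; congr pair; exact: ord_inj.
Qed.

Let v_block b x (a : 'I_p * 'I_n) : v b x a.1 a.2 != 0 -> (a.1 %/ m)%N = b.
Proof.
rewrite mxE; have [e _|] := eqVneq a.1 (row_of b x.1); last by rewrite eqxx.
by rewrite e /= divnMDl// divn_small ?addn0.
Qed.

Let prior_Theta1 (f : {ffun 'I_s -> K}) :
  \sum_b v b (f b) \in @Theta1_1side R p n rho s.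
Proof.
pose b0 := Ordinal s0; pose k0 := (f b0).2.
have fk b : (f b).2 = k0.
  case: sL => [s1|L1]; last first.
    by apply: ord_inj; case: (f b).2 => /= x xL; case: k0 => /= y yL; lia.
  by congr (f _).2; apply: ord_inj; case: b => /= x xs; lia.
pose mu1 j := \sum_b (if j == row_of b (f b).1 then mu k0 else 0).
rewrite inE; exists (t k0), mu1, (fun=> 0), [set row_of b (f b).1 | b : 'I_s]%SET.
split => //.
- by have := t_lt (ltn_ord k0); lia.
- rewrite card_imset ?card_ord// => b c /(congr1 val)/= e.
  have : ((b * m + (f b).1) %/ m = (c * m + (f c).1) %/ m)%N by rewrite e.
  by rewrite !divnMDl// !divn_small// !addn0; exact: ord_inj.
- move=> j i; rewrite summxE /mu1; case: ifP => ik; last first.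
    apply: big1 => b _; rewrite mxE fk ik; by case: ifP.
  by apply: eq_bigr => b _; rewrite mxE fk ik.
- move=> j /imsetP[b _ ->]; rewrite subr0.
  have -> : rho = Num.sqrt ((t k0 * (n - t k0))%:R / n%:R) * mu k0.
    by rewrite /mu mulrC divfK// gt_eqF// scale_gt0.
  rewrite ler_wpM2l ?sqrtr_ge0// /mu1 (bigD1 b)//= eqxx lerDl sumr_ge0// => c _.
  by case: ifP.
Qed.

Lemma risk_lower : ((lower_const u
    (block_bound ('I_m * 'I_L)%type u prior_norm eta ^+ s))%:E <= risk_1side p n rho s)%E.
Proof.
have K0 : (0 < #|K|)%N by rewrite card_prod !card_ord muln_gt0 m0.
apply: risk_ge => [|psi B mpsi hB].
  have /card_gt0P[x _] := K0.
  by exists (\sum_b v b ([ffun=> x] b)); have := prior_Theta1 [ffun=> x]; rewrite inE.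
apply: (@block_lower R p n s K v (fun a => a.1 %/ m)%N) => //.
by move=> f; exact: hB.
Qed.

End lower_risk.

(** * Asymptotics *)

Section convergence.
Context {R : realType}.
Implicit Types f : nat -> \bar R.

Lemma cvg_ereal0 f :
  (forall e : R, 0 < e -> \forall p \near \oo, (0 <= f p <= e%:E)%E) -> f @ \oo --> 0%E.
Proof.
move=> hf; apply/fine_cvgP; split.
  have := hf 1 ltr01; apply: filterS => p /andP[p0 p1].
  by rewrite ge0_fin_numE// (le_lt_trans p1) ?ltry.
apply/cvgrPdist_le => e e0; have := hf e e0; apply: filterS => p /andP[p0 p1] /=.
have fp : f p \is a fin_num by rewrite ge0_fin_numE// (le_lt_trans p1) ?ltry.
by rewrite sub0r normrN ger0_norm ?fine_ge0// -lee_fin fineK.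
Qed.

Lemma not_cvg_ereal0 f (c : R) : 0 < c ->
  (\forall p \near \oo, (c%:E <= f p)%E) -> ~ (f @ \oo --> 0%E).
Proof.
move=> c0 hf /fine_cvgP[ffin /cvgrPdist_lt /(_ c c0) fc].
have [p [h1 h2 h3]] : exists p, [/\ (c%:E <= f p)%E, f p \is a fin_num & `|0 - fine (f p)| < c].
  have [N _ HN] := filterI (filterI hf ffin) fc.
  by have [[? ?] ?] := HN N (leqnn N); exists N.
move: h3; rewrite sub0r normrN ltNge => /negP; apply.
by rewrite (le_trans _ (ler_norm _))// -lee_fin fineK.
Qed.

End convergence.

(** * Consequences of the growth conditions on [n] and [s] *)

Section growth.
Context {R : realType} (a beta : R) (n s : nat -> nat).
Hypothesis a0 : 0 < a.
Hypothesis hn : (fun p : nat => ln (ln (n p)%:R) / (a * ln p%:R)) @ \oo --> (1 : R).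
Hypothesis hs : (fun p : nat => (s p)%:R / (p%:R `^ (1 - beta))) @ \oo --> (1 : R).

Local Notation ell p := (ln (p%:R : R)).

Lemma ln_nat_large (C : R) : \forall p \near \oo, C <= ell p.
Proof.
have := nbhs_infty_ger (expR C); apply: filterS => p hp.
by rewrite -[C]expRK ler_ln ?posrE ?expR_gt0// (lt_le_trans _ hp) ?expR_gt0.
Qed.

Lemma expR_ln_nat p : (0 < p)%N -> expR (ell p) = p%:R.
Proof. by move=> p0; rewrite lnK// posrE ltr0n. Qed.

Lemma s_bounds : \forall p \near \oo,
  expR ((1 - beta) * ell p) / 2 <= (s p)%:R <= 2 * expR ((1 - beta) * ell p).
Proof.
have h1 := @cvgr_ge _ _ _ _ _ _ hs (1 / 2); have h2 := @cvgr_le _ _ _ _ _ _ hs 2.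
near=> p.
have p0 : (0 < p)%N by near: p; exact: nbhs_infty_gt.
have pE : p%:R `^ (1 - beta) = expR ((1 - beta) * ell p) :> R.
  by rewrite /powR pnatr_eq0 gtn_eqF.
have E0 := expR_gt0 ((1 - beta) * ell p).
have : 1 / 2 <= (s p)%:R / expR ((1 - beta) * ell p) :> R.
  by rewrite -pE; near: p; apply: h1; lra.
have : (s p)%:R / expR ((1 - beta) * ell p) <= 2 :> R.
  by rewrite -pE; near: p; apply: h2; lra.
by rewrite ler_pdivrMr// ler_pdivlMr// => ? ?; apply/andP; split; lra.
Unshelve. all: by end_near. Qed.

Lemma n_bounds (e : R) : 0 < e -> \forall p \near \oo,
  [/\ (1 : R) < ln (n p)%:R, expR ((a - e) * ell p) <= ln (n p)%:R &
      ln (n p)%:R <= expR ((a + e) * ell p)].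
Proof.
move=> e0; pose d := e / a.
have d0 : 0 < d by rewrite divr_gt0.
have h0 := @cvgr_gt _ _ _ _ _ _ hn 0; have h1 := @cvgr_ge _ _ _ _ _ _ hn (1 - d).
have h2 := @cvgr_le _ _ _ _ _ _ hn (1 + d).
near=> p.
have l0 : 0 < ell p by apply: (@lt_le_trans _ _ 1) => //; near: p; exact: ln_nat_large.
have al0 : 0 < a * ell p by rewrite mulr_gt0.
have g0 : 0 < ln (ln (n p)%:R) / (a * ell p) by near: p; apply: h0.
have g1 : 1 - d <= ln (ln (n p)%:R) / (a * ell p) by near: p; apply: h1; lra.
have g2 : ln (ln (n p)%:R) / (a * ell p) <= 1 + d by near: p; apply: h2; lra.
(* A positive ratio excludes ln n <= 1, where the outer logarithm is nonpositive, the default value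
   0 included. *)
have L1 : (1 : R) < ln (n p)%:R.
  rewrite ltNge; apply/negP => /ln_le0 h.
  by move: g0; rewrite ltNge pmulr_lle0 ?invr_gt0// h.
have L0 : (0 : R) < ln (n p)%:R by rewrite (lt_trans _ L1).
have ad : a * d = e by rewrite /d mulrC divfK// gt_eqF.
rewrite ler_pdivlMr// in g1; rewrite ler_pdivrMr// in g2.
split => //; rewrite -[ln (n p)%:R](lnK L0) ler_expR.
  apply: le_trans g1; rewrite le_eqVlt; apply/orP; left; apply/eqP.
  by rewrite -ad; ring.
apply: le_trans g2 _; rewrite le_eqVlt; apply/orP; left; apply/eqP.
by rewrite -ad; ring.
Unshelve. all: by end_near. Qed.

Lemma n_large (C : R) : \forall p \near \oo, C * ell p <= ln (n p)%:R.
Proof.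
have a2 : 0 < a / 2 by rewrite divr_gt0.
near=> p.
have [_ L _] : [/\ 1 < ln (n p)%:R :> R, expR ((a - a / 2) * ell p) <= ln (n p)%:R &
    ln (n p)%:R <= expR ((a + a / 2) * ell p)] by near: p; exact: n_bounds.
apply: le_trans L.
have l0 : 0 <= ell p by near: p; exact: ln_nat_large.
have -> : a - a / 2 = a / 2 by field.
(* The argument 1 selects exp(x) >= 1 + x^2/2, which beats any linear function. *)
have := @expR_ge1Dxn R (a / 2 * ell p) 1 (mulr_ge0 (ltW a2) l0).
apply: le_trans.
have lC : C * 2 / (a / 2) ^+ 2 <= ell p by near: p; exact: ln_nat_large.
rewrite ler_pdivrMr ?exprn_gt0// in lC.
have := ler_wpM2r l0 lC.
rewrite (_ : ell p * (a / 2) ^+ 2 * ell p = (a / 2 * ell p) ^+ 2); last by ring.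
by rewrite (_ : 2`! = 2)%N//; lra.
Unshelve. all: by end_near. Qed.

End growth.

Section lower_const.
Context {R : realType}.
Implicit Types u C : R.

Lemma lower_const_gt0 u C : 0 <= C -> 0 < lower_const u C.
Proof. by move=> C0; rewrite invr_gt0 mulr_gt0// powR_gt0//; lra. Qed.

Lemma le_lower_const u C C' : 0 < u -> 0 <= C -> C <= C' ->
  lower_const u C' <= lower_const u C.
Proof.
move=> u0 C0 CC; have C'0 := le_trans C0 CC.
have P x : 0 <= x -> 0 < 2 * (2 * (x + 1)) `^ u^-1 :> R.
  by move=> x0; rewrite mulr_gt0// powR_gt0//; lra.
rewrite /lower_const lef_pV2 ?posrE ?P// ler_pM2l//.
apply: ge0_ler_powR; rewrite ?nnegrE ?invr_ge0 ?(ltW u0)//; lra.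
Qed.

Lemma block_bound_ge0 (K : finType) u V eta : 0 < u -> u <= 1 -> 0 <= block_bound K u V eta.
Proof.
by move=> u0 u1; rewrite addr_ge0 ?mulr_ge0 ?powR_ge0 ?expR_ge0 ?(ltW u0)//
  addr_ge0 ?subr_ge0// mulr_ge0 ?powR_ge0 ?expR_ge0.
Qed.

Lemma powRN_le (N u x : R) : 0 <= u -> 0 < N -> expR x <= N -> N `^ (- u) <= expR (- u * x).
Proof.
move=> u0 N0 xN; rewrite /powR gt_eqF// ler_expR !mulNr lerN2 ler_wpM2l//.
by rewrite -[x]expRK ler_ln ?posrE ?expR_gt0.
Qed.

End lower_const.

(** * Lower bound for beta < 1 *)

Section lower.
Context {R : realType} (a beta : R) (n s : nat -> nat) (r : R).
Hypotheses (a0 : 0 < a) (beta0 : 0 < beta).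
Hypothesis hn : (fun p : nat => ln (ln (n p)%:R) / (a * ln p%:R)) @ \oo --> (1 : R).
Hypothesis hs : (fun p : nat => (s p)%:R / (p%:R `^ (1 - beta))) @ \oo --> (1 : R).
Hypothesis r0 : 0 < r.

Local Notation ell p := (ln (p%:R : R)).
Local Notation rho p := (Num.sqrt (2 * r * ell p)).

(** Here q = p, so the factor 1/(1 - p^(-2)) tends to 1 and fits between r and r'. *)
Lemma prior_norm_bound (r' : R) : r < r' ->
  \forall p \near \oo, prior_norm p (rho p) <= 2 * r' * ell p.
Proof.
move=> rr; have r'0 : 0 < r' := lt_trans r0 rr.
near=> p.
have p1 : (1 < p)%N by near: p; exact: nbhs_infty_gt.
have pR : r' / (r' - r) <= p%:R by near: p; exact: nbhs_infty_ger.
have l0 : 0 <= ell p by near: p; exact: ln_nat_large.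
have p2 : (1 : R) < (p ^ 2)%:R by rewrite ltr1n -(exp1n 2) ltn_exp2r.
have p20 : (0 : R) < (p ^ 2)%:R by rewrite (lt_trans _ p2).
rewrite /prior_norm sqr_sqrtr; last by rewrite !mulr_ge0// ltW.
rewrite ler_pdivrMr ?subr_gt0 ?invf_lt1//.
have H : r' <= (r' - r) * (p ^ 2)%:R.
  rewrite mulrC -ler_pdivrMr ?subr_gt0//; apply: (le_trans pR).
  by rewrite ler_nat -{1}(expn1 p) leq_exp2l.
have H2 : r <= r' * (1 - (p ^ 2)%:R^-1).
  rewrite mulrBr mulr1 lerBrDl -lerBrDr ler_pdivrMr//.
by have := ler_wpM2r l0 H2; lra.
Unshelve. all: by end_near. Qed.

Lemma sqr_le_n : \forall p \near \oo, (p ^ 2 <= n p)%N.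
Proof.
near=> p.
have p0 : (0 < p)%N by near: p; exact: nbhs_infty_gt.
have L : 2 * ell p <= ln (n p)%:R by near: p; exact: (n_large a0 hn).
have [L1 _ _] : [/\ 1 < ln (n p)%:R :> R, expR ((a - 1) * ell p) <= ln (n p)%:R &
    ln (n p)%:R <= expR ((a + 1) * ell p)] by near: p; exact: (n_bounds a0 hn).
have n0 : (0 < n p)%N.
  by rewrite lt0n; apply/eqP => n0; move: L1; rewrite n0 ln0// ltr10.
rewrite -(ler_nat R) -ler_ln ?posrE ?ltr0n ?expn_gt0 ?p0//.
by rewrite natrX lnXn ?ltr0n// mulr2n; lra.
Unshelve. all: by end_near. Qed.

(** Uses the one change point t = 1 and blocks of m = floor(p/s) rows, so distinct atoms are
    orthogonal and eta = 0. The last hypothesis says that [block_bound] exceeds 1 by O(1/s), which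
    keeps its s-th power bounded. *)
Lemma risk_lower_sparse (r' u : R) : r < r' -> 0 < u -> u <= 1 -> beta < 1 ->
  1 - beta - beta * u + r' * u * (1 + u) <= 0 ->
  exists2 c : R, 0 < c &
    \forall p \near \oo, (c%:E <= risk_1side p (n p) (rho p) (s p))%E.
Proof.
move=> rr u0 u1 b1 hexp.
(* The 2 comes from s <= 2 p^(1-beta), and the 4^u from m >= p^beta/4. *)
pose C : R := expR (2 * expR (u * ln 4)).
exists (lower_const u C); first by rewrite lower_const_gt0// expR_ge0.
near=> p.
have p1 : (1 < p)%N by near: p; exact: nbhs_infty_gt.
have l0 : 0 <= ell p by near: p; exact: ln_nat_large.
have V : prior_norm p (rho p) <= 2 * r' * ell p by near: p; exact: prior_norm_bound.
have n2 : (p ^ 2 <= n p)%N by near: p; exact: sqr_le_n.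
have sb : expR ((1 - beta) * ell p) / 2 <= (s p)%:R <= 2 * expR ((1 - beta) * ell p).
  by near: p; exact: (s_bounds hs).
have bl : ln 2 <= beta * ell p.
  by rewrite -ler_pdivrMl//; near: p; exact: ln_nat_large.
have pE : expR (ell p) = p%:R by rewrite expR_ln_nat// ltnW.
move/andP: sb => [sb1 sb2].
have s0 : (0 < s p)%N.
  by rewrite -(ltr0n R) (lt_le_trans _ sb1)// divr_gt0// expR_gt0.
have sp : (s p <= p)%N.
  rewrite -(ler_nat R) (le_trans sb2)// -[leRHS]pE -[X in X * _](@lnK R) ?posrE//.
  by rewrite -expRD ler_expR; lra.
pose m := (p %/ s p)%N.
have m0 : (0 < m)%N by rewrite divn_gt0.
have mN : expR (beta * ell p - ln 4) <= m%:R.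
  have h : p%:R <= 2 * m%:R * (s p)%:R :> R.
    rewrite -!natrM ler_nat; apply: (@leq_trans (m.+1 * s p)).
      by rewrite ltnW// ltn_ceil.
    by rewrite leq_mul2r mul2n -addnn -addn1 leq_add2l m0 orbT.
  rewrite expRD expRN lnK ?posrE// ler_pdivrMr//.
  have E1 := expR_gt0 ((1 - beta) * ell p).
  have E2 : expR (beta * ell p) * expR ((1 - beta) * ell p) = p%:R.
    by rewrite -expRD -[RHS]pE; congr expR; ring.
  rewrite -(ler_pM2r E1) E2; apply: (le_trans h).
  have : 2 * m%:R * (s p)%:R <= 2 * m%:R * (2 * expR ((1 - beta) * ell p)).
    by rewrite ler_wpM2l// mulr_ge0.
  lra.
have sm : (s p * m <= p)%N by rewrite mulnC leq_trunc_div.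
have n2' : ((p ^ 2) ^ 1 <= n p)%N by rewrite expn1.
have L1 : (1 < 1)%N -> prior_norm p (rho p) / p%:R <= 0 by [].
apply: le_trans (risk_lower s0 m0 (ltnSn 0) sm p1 n2' (or_intror erefl)
  (sqrtr_ge0 _) u0 u1 (lexx 0) L1).
rewrite lee_fin; apply: le_lower_const => //.
  exact: exprn_ge0 (block_bound_ge0 _ _ _ u0 u1).
set bb := block_bound _ _ _ _.
pose z : R := expR (u * ln 4 - u * beta * ell p + r' * u * (1 + u) * ell p).
have bbz : bb <= expR z.
  apply: le_trans (expR_ge1Dx z).
  have h (x y w : R) : x <= y -> x + (1 - w) + w <= 1 + y by lra.
  rewrite /bb /block_bound expR0 mulr1; apply: h.
  rewrite card_prod !card_ord muln1.
  apply: (@le_trans _ _ (expR (- u * (beta * ell p - ln 4)) *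
      expR (2 * r' * ell p * (u * (1 + u) / 2)))).
    apply: ler_pM; rewrite ?powR_ge0 ?expR_ge0//.
      by apply: powRN_le => //; [exact: ltW|rewrite ltr0n].
    rewrite ler_expR ler_wpM2r// divr_ge0// mulr_ge0 ?(ltW u0)// addr_ge0// ltW//.
  rewrite -expRD /z ler_expR le_eqVlt; apply/orP; left; apply/eqP; by field.
have bb0 : 0 <= bb by exact: block_bound_ge0.
rewrite /C; apply: (@le_trans _ _ (expR ((s p)%:R * z))).
  by rewrite expRM_natl lerXn2r ?nnegrE ?expR_ge0.
rewrite ler_expR.
apply: (@le_trans _ _ (2 * expR ((1 - beta) * ell p) * z)).
  by rewrite ler_wpM2r ?expR_ge0.
rewrite -mulrA ler_wpM2l// /z -expRD ler_expR.
have := mulr_le0_ge0 hexp l0; lra.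
Unshelve. all: by end_near. Qed.

End lower.

(** * Lower bound for beta = 1 *)

Section lower_single.
Context {R : realType} (a : R) (n s : nat -> nat) (r : R).
Hypotheses (a0 : 0 < a).
Hypothesis hn : (fun p : nat => ln (ln (n p)%:R) / (a * ln p%:R)) @ \oo --> (1 : R).
Hypothesis hs : (fun p : nat => (s p)%:R / (p%:R `^ (1 - 1))) @ \oo --> (1 : R).
Hypothesis r0 : 0 < r.

Local Notation ell p := (ln (p%:R : R)).
Local Notation rho p := (Num.sqrt (2 * r * ell p)).

Lemma s_eq1 : \forall p \near \oo, s p = 1%N.
Proof.
have h1 := @cvgr_gt _ _ _ _ _ _ hs (1 / 2); have h2 := @cvgr_lt _ _ _ _ _ _ hs (3 / 2).
near=> p.
have : 1 / 2 < (s p)%:R / (p%:R `^ (1 - 1)) :> R by near: p; apply: h1; lra.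
have : (s p)%:R / (p%:R `^ (1 - 1)) < 3 / 2 :> R by near: p; apply: h2; lra.
rewrite subrr powRr0 divr1; case: (s p) => [|[|k]] // H1 H2.
  by exfalso; move: H2; rewrite mulr0n; lra.
exfalso; move: H1; rewrite -natr1 -natr1; have : 0 <= k%:R :> R by []; lra.
Unshelve. all: by end_near. Qed.

(** One block with p L atoms, where L is of order log n/log p. Of the loss [2 * e], one [e] comes
    from the bounds on log n and one absorbs 4 log p. Cross terms stay bounded since log p <= p, and
    a bounded moment is enough for a single block. *)
Lemma risk_lower_single (r' u e : R) : r < r' -> 0 < u -> u <= 1 -> 0 < e ->
  r' * (1 + u) <= 1 + a - 2 * e ->
  exists2 c : R, 0 < c &
    \forall p \near \oo, (c%:E <= risk_1side p (n p) (rho p) (s p))%E.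
Proof.
move=> rr u0 u1 e0 hexp; have r'0 : 0 < r' := lt_trans r0 rr.
pose C : R := 1 + (1 - u) + u * expR (2 * r').
exists (lower_const u C).
  by apply: lower_const_gt0; rewrite /C addr_ge0 ?mulr_ge0 ?expR_ge0 ?(ltW u0)//
    addr_ge0// subr_ge0.
near=> p.
have p1 : (1 < p)%N by near: p; exact: nbhs_infty_gt.
have p0 : (0 < p)%N := ltnW p1.
have l1 : 1 <= ell p by near: p; exact: ln_nat_large.
have l0 : 0 < ell p := lt_le_trans ltr01 l1.
have V : prior_norm p (rho p) <= 2 * r' * ell p by near: p; exact: prior_norm_bound.
have n2 : (p ^ 2 <= n p)%N by near: p; exact: (sqr_le_n a0 hn).
have s1 : s p = 1%N by near: p; exact: s_eq1.
have pE : expR (ell p) = p%:R by exact: expR_ln_nat.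
have [L1 Ln _] : [/\ 1 < ln (n p)%:R :> R, expR ((a - e) * ell p) <= ln (n p)%:R &
    ln (n p)%:R <= expR ((a + e) * ell p)] by near: p; exact: (n_bounds a0 hn).
have le8 : 8 / e ^+ 2 <= ell p by near: p; exact: ln_nat_large.
have le4 : 4 * ell p <= expR (e * ell p).
  have := @expR_ge1Dxn R (e * ell p) 1 (mulr_ge0 (ltW e0) (ltW l0)).
  rewrite ler_pdivrMr ?exprn_gt0// in le8.
  have := ler_wpM2r (ltW l0) le8.
  rewrite (_ : ell p * e ^+ 2 * ell p = (e * ell p) ^+ 2); last by ring.
  by rewrite (_ : 2`! = 2)%N//; lra.
have q2 : (1 < p ^ 2)%N by rewrite -(exp1n 2) ltn_exp2r.
have n0 : (0 < n p)%N by rewrite (leq_trans _ n2)// ltnW.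
pose L := trunc_log (p ^ 2) (n p).
have LP : ((p ^ 2) ^ L <= n p)%N by exact: trunc_logP.
have L0 : (0 < L)%N by rewrite /L trunc_log_gt0 q2 /= prednK ?n2// (ltn_trans _ q2).
have NL : expR ((1 + a - 2 * e) * ell p) <= (p * L)%:R.
  have h1 : ln (n p)%:R <= L.+1%:R * (2 * ell p).
    have : ((n p)%:R : R) <= ((p ^ 2) ^ L.+1)%:R.
      by rewrite ler_nat ltnW// trunc_log_ltn.
    rewrite -ler_ln ?posrE ?ltr0n ?expn_gt0 ?p0//.
    rewrite natrX lnXn ?natrX ?exprn_gt0 ?ltr0n// lnXn ?ltr0n//.
    by rewrite -[X in _ <= X]mulr_natl -[ell p *+ 2]mulr_natl.
  have h2 : L.+1%:R <= 2 * L%:R :> R.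
    by rewrite -natrM ler_nat mul2n -addnn -addn1 leq_add2l.
  have h3 : ln (n p)%:R <= L%:R * (4 * ell p).
    by apply: (le_trans h1); have := ler_wpM2r (ltW l0) h2; lra.
  have h4 : expR ((a - e) * ell p) <= L%:R * expR (e * ell p).
    by apply: (le_trans Ln); apply: (le_trans h3); rewrite ler_wpM2l.
  rewrite natrM -[X in X * L%:R]pE.
  rewrite (_ : _ * ell p = ell p + ((a - e) * ell p - e * ell p)); last by ring.
  rewrite expRD ler_wpM2l ?expR_ge0// expRD expRN ler_pdivrMr ?expR_gt0//.
have smp : (1 * p <= p)%N by rewrite mul1n.
have eta0 : 0 <= 2 * r' by rewrite mulr_ge0// ltW.
have eta_ge : (1 < L)%N -> prior_norm p (rho p) / p%:R <= 2 * r'.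
  move=> _; rewrite ler_pdivrMr ?ltr0n//; apply: (le_trans V).
  rewrite ler_wpM2l// -[leRHS]pE.
  by apply: le_trans (expR_ge1Dx _); rewrite lerDr.
rewrite s1.
apply: le_trans (risk_lower (ltnSn 0) p0 L0 smp p1 LP (or_introl erefl)
  (sqrtr_ge0 _) u0 u1 eta0 eta_ge).
rewrite lee_fin expr1; apply: le_lower_const => //.
  exact: (block_bound_ge0 _ _ _ u0 u1).
rewrite /block_bound card_prod !card_ord /C !lerD2r.
apply: (@le_trans _ _ (expR (- u * ((1 + a - 2 * e) * ell p)) *
    expR (2 * r' * ell p * (u * (1 + u) / 2)))).
  apply: ler_pM; rewrite ?powR_ge0 ?expR_ge0//.
    by apply: powRN_le => //; [exact: ltW|rewrite ltr0n muln_gt0 p0].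
  by rewrite ler_expR ler_wpM2r// divr_ge0// mulr_ge0 ?(ltW u0)// addr_ge0// ltW.
rewrite -expRD expR_le1.
have -> : - u * ((1 + a - 2 * e) * ell p) + 2 * r' * ell p * (u * (1 + u) / 2) =
    u * ell p * (r' * (1 + u) - (1 + a - 2 * e)) by field.
by rewrite mulr_ge0_le0 ?subr_le0// mulr_ge0 ?(ltW u0) ?(ltW l0).
Unshelve. all: by end_near. Qed.

End lower_single.

Section lower_bound.
Context {R : realType} (a beta : R) (n s : nat -> nat) (r : R).

(* For [3/4 < beta] the choice [u = c / (1 - c)], [c = sqrt (1 - beta)], gives equality. *)
Lemma sparse_exponents : 1 / 2 < beta -> beta < 1 -> 0 < r -> r < r2star a beta ->
  exists r' u : R, [/\ r < r', 0 < u, u <= 1 & 1 - beta - beta * u + r' * u * (1 + u) <= 0].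
Proof.
move=> b2 b1 r0; rewrite /r2star; case: (leP beta (3 / 4)) => [b34|b34] hr.
  by exists (beta - 1 / 2), 1; split => //; lra.
rewrite b1 in hr; set c := Num.sqrt (1 - beta) in hr.
have c2 : c ^+ 2 = 1 - beta by rewrite sqr_sqrtr//; lra.
have c0 : 0 < c by rewrite sqrtr_gt0; lra.
have c12 : c < 1 / 2.
  by rewrite -ltr_sqr ?nnegrE ?(ltW c0)// c2 !expr2; lra.
exists ((1 - c) ^+ 2), (c / (1 - c)); split => //.
- by rewrite divr_gt0// subr_gt0; lra.
- by rewrite ler_pdivrMr; lra.
have -> : beta = 1 - c ^+ 2 by rewrite c2; ring.
rewrite (_ : _ + _ = 0)//; field.
by rewrite subr_eq0; apply/eqP; lra.
Qed.

Lemma single_exponents : 0 < a -> 0 < r -> r < 1 + a ->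
  exists r' u e : R, [/\ r < r', 0 < u, u <= 1, 0 < e & r' * (1 + u) <= 1 + a - 2 * e].
Proof.
move=> a0 r0 ra; pose d := 1 + a - r; pose r' := r + d / 2.
have d0 : 0 < d by rewrite subr_gt0.
have r'0 : 0 < r' by rewrite /r'; lra.
(* Half of the slack d goes to r' - r, a quarter to r' u and a quarter to 2e. *)
exists r', (Num.min 1 (d / (4 * r'))), (d / 8).
have u0 : 0 < d / (4 * r') by rewrite divr_gt0// mulr_gt0.
split.
- by rewrite /r'; lra.
- by rewrite lt_min ltr01.
- by rewrite ge_min lexx.
- by rewrite divr_gt0.
have : r' * Num.min 1 (d / (4 * r')) <= r' * (d / (4 * r')).
  by rewrite ler_wpM2l ?(ltW r'0)// ge_min lexx orbT.
rewrite (_ : r' * (d / (4 * r')) = d / 4); last by field; rewrite gt_eqF.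
have rE : r' = r + d / 2 by [].
have dE : d = 1 + a - r by [].
move: (Num.min _ _) => w H; rewrite mulrDr mulr1.
by move: (r' * w) H => x H; lra.
Qed.

End lower_bound.

(** * Asymptotics of the two tests *)

Section upper.
Context {R : realType} (a beta : R) (n s : nat -> nat) (r : R).
Hypotheses (a0 : 0 < a) (beta0 : 0 < beta).
Hypothesis hn : (fun p : nat => ln (ln (n p)%:R) / (a * ln p%:R)) @ \oo --> (1 : R).
Hypothesis hs : (fun p : nat => (s p)%:R / (p%:R `^ (1 - beta))) @ \oo --> (1 : R).
Hypothesis r0 : 0 < r.

Local Notation ell p := (ln (p%:R : R)).
Local Notation rho p := (Num.sqrt (2 * r * ell p)).

Lemma s_gt0 : \forall p \near \oo, (0 < s p)%N.
Proof.
have h := s_bounds hs; near=> p.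
have /andP[sb _] : expR ((1 - beta) * ell p) / 2 <= (s p)%:R <= 2 * expR ((1 - beta) * ell p).
  by near: p.
by rewrite -(ltr0n R) (lt_le_trans _ sb)// divr_gt0// expR_gt0.
Unshelve. all: by end_near. Qed.

Lemma s_le : \forall p \near \oo, (s p <= p)%N.
Proof.
have h := s_bounds hs; near=> p.
have /andP[_ sb] : expR ((1 - beta) * ell p) / 2 <= (s p)%:R <= 2 * expR ((1 - beta) * ell p).
  by near: p.
have p0 : (0 < p)%N by near: p; exact: nbhs_infty_gt.
have bl : ln 2 <= beta * ell p.
  by rewrite -ler_pdivrMl//; near: p; exact: ln_nat_large.
rewrite -(ler_nat R) (le_trans sb)// -[leRHS](expR_ln_nat p0) -[X in X * _](@lnK R) ?posrE//.
by rewrite -expRD ler_expR; lra.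
Unshelve. all: by end_near. Qed.

(** An empty alternative would have supremum -oo, so a member is exhibited: all rows jump after the
    first column. *)
Lemma risk_ge0 : \forall p \near \oo, (0 <= risk_1side p (n p) (rho p) (s p))%E.
Proof.
near=> p.
have sp : (s p <= p)%N by near: p; exact: s_le.
have n2 : (p ^ 2 <= n p)%N by near: p; exact: (sqr_le_n a0 hn).
have p1 : (1 < p)%N by near: p; exact: nbhs_infty_gt.
have n1 : (1 < n p)%N by rewrite (leq_trans _ n2)// -(exp1n 2) ltn_exp2r.
pose m1 := rho p / cusum_scale (n p) 1.
pose th : 'M[R]_(p, n p) := \matrix_(j, i) if (i < 1)%N then m1 else 0.
have thT : Theta1_1side (rho p) (s p) th.
  exists 1%N, (fun=> m1), (fun=> 0), [set: 'I_p]%SET; split => //.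
  - by rewrite -subn_gt0 in n1.
  - by rewrite cardsT card_ord.
  - by move=> j i; rewrite mxE.
  - by move=> j _; rewrite subr0 /m1 [leRHS]mulrC divfK// gt_eqF// cusum_scale_gt0.
apply: risk_ge => [|psi B mpsi hB]; first by exists th.
have := le_trans (esp_ge0 th (nnmeasR_test (measurable_testN mpsi))) (hB th (mem_set thT)).
by move=> B0; rewrite adde_ge0// esp_ge0//; exact: nnmeasR_test.
Unshelve. all: by end_near. Qed.

Lemma ln2_ge : 1 / 2 <= ln 2 :> R.
Proof.
rewrite -[1 / 2]expRK ler_ln ?posrE ?expR_gt0//.
by have := @expR_quadratic R (1 / 2) (lexx _); lra.
Qed.

Lemma grid_size_bound (B : nat) (e : R) : 0 < e -> \forall p \near \oo,
  (grid_size (n p) B)%:R <= (2 ^ B.+2)%:R * 3 * expR ((a + e) * ell p).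
Proof.
move=> e0; near=> p.
have [L1 _ Ln] : [/\ 1 < ln (n p)%:R :> R, expR ((a - e) * ell p) <= ln (n p)%:R &
    ln (n p)%:R <= expR ((a + e) * ell p)] by near: p; exact: (n_bounds a0 hn).
have n0 : (0 < n p)%N.
  by rewrite lt0n; apply/eqP => n0; move: L1; rewrite n0 ln0// ltr10.
rewrite /grid_size natrM -mulrA ler_wpM2l//.
(* With ln 2 >= 1/2 this yields trunc_log <= 2 ln n; the extra 1 is below ln n, giving the factor
   3. *)
have h : (trunc_log 2 (n p))%:R * ln 2 <= ln (n p)%:R :> R.
  have : (2 ^ trunc_log 2 (n p))%:R <= (n p)%:R :> R by rewrite ler_nat trunc_logP.
  rewrite -ler_ln ?posrE ?ltr0n ?expn_gt0//.
  by rewrite natrX lnXn// -[X in X <= _]mulr_natl.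
have h2 : (trunc_log 2 (n p))%:R * (1 / 2) <= (trunc_log 2 (n p))%:R * ln 2 :> R.
  by rewrite ler_wpM2l// ln2_ge.
by rewrite -natr1; lra.
Unshelve. all: by end_near. Qed.

Lemma rhoE p : rho p = Num.sqrt r * Num.sqrt (2 * ell p).
Proof. by rewrite -sqrtrM ?(ltW r0)//; congr Num.sqrt; ring. Qed.

Lemma scale_sqr p (k : R) : (0 < p)%N -> (k * Num.sqrt (2 * ell p)) ^+ 2 = k ^+ 2 * (2 * ell p).
Proof.
move=> p0; rewrite exprMn sqr_sqrtr// mulr_ge0// ln_ge0// ler1n//.
Qed.

Lemma tail_scale p (k : R) : (0 < p)%N ->
  tail_bound (k * Num.sqrt (2 * ell p)) = 2 * expR (- (k ^+ 2 * ell p)).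
Proof. by move=> p0; rewrite /tail_bound scale_sqr//; congr (_ * expR _); field. Qed.

Lemma expR_small (C h e : R) : 0 < h -> 0 < e ->
  \forall p \near \oo, C * expR (- (h * ell p)) <= e.
Proof.
move=> h0 e0; near=> p.
have [C0|C0] := leP C 0; first by rewrite (le_trans _ (ltW e0))// mulr_le0_ge0 ?expR_ge0.
have H : ln (C / e) / h <= ell p by near: p; exact: ln_nat_large.
rewrite ler_pdivrMr// -ler_expR lnK ?posrE ?divr_gt0// ler_pdivrMr// in H.
by rewrite expRN mulrC ler_pdivrMl ?expR_gt0// [h * _]mulrC.
Unshelve. all: by end_near. Qed.

Section single.
Variables (k k' : R) (B : nat).
Hypotheses (k0 : 0 < k) (kk : k < k') (ka : 1 + a < k ^+ 2).
Hypothesis kB : k' <= grid_loss B * Num.sqrt r.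

(** Under the null, p^(a+e) grid points and p rows meet a tail p^(-k^2), leaving p^(-e). Under the
    alternative one signal row is missed with probability at most p^(-(k'-k)^2). *)
Lemma risk_upper_single (e0 : R) : 0 < e0 ->
  \forall p \near \oo, (risk_1side p (n p) (rho p) (s p) <= e0%:E)%E.
Proof.
move=> e00; pose e := (k ^+ 2 - (1 + a)) / 2.
have e1 : 0 < e by rewrite divr_gt0// subr_gt0.
have e2 : 0 < e0 / 2 by rewrite divr_gt0.
have kd : 0 < (k' - k) ^+ 2 by rewrite exprn_gt0// subr_gt0.
near=> p.
have p0 : (0 < p)%N by near: p; exact: nbhs_infty_gt.
have s0 : (0 < s p)%N by near: p; exact: s_gt0.
pose y := Num.sqrt (2 * ell p); have y0 : 0 <= y by exact: sqrtr_ge0.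
have kr : k' * y <= grid_loss B * rho p by rewrite rhoE mulrA ler_wpM2r.
have ky : k * y <= k' * y by rewrite ler_wpM2r// ltW.
have H1 : (2 ^ B.+2)%:R * 3 * 2 * expR (- (e * ell p)) <= e0 / 2.
  by near: p; exact: expR_small.
have H2 : 1 * expR (- ((k' - k) ^+ 2 * ell p)) <= e0 / 2 by near: p; exact: expR_small.
have G : (grid_size (n p) B)%:R <= (2 ^ B.+2)%:R * 3 * expR ((a + e) * ell p).
  by near: p; exact: grid_size_bound.
apply: le_trans (risk_max_le p (n p) (mulr_ge0 (ltW k0) y0) (le_trans ky kr) s0 (sqrtr_ge0 _)) _.
rewrite lee_fin (_ : e0 = e0 / 2 + e0 / 2); last by field.
apply: lerD.
  rewrite tail_scale//; apply: le_trans H1.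
  have pt0 : 0 <= p%:R * (2 * expR (- (k ^+ 2 * ell p))) by rewrite !mulr_ge0 ?expR_ge0.
  apply: le_trans (ler_wpM2r pt0 G) _.
  have -> : (2 ^ B.+2)%:R * 3 * expR ((a + e) * ell p) *
      (p%:R * (2 * expR (- (k ^+ 2 * ell p)))) = (2 ^ B.+2)%:R * 3 * 2 *
      (expR ((a + e) * ell p) * expR (ell p) * expR (- (k ^+ 2 * ell p))).
    by rewrite expR_ln_nat//; ring.
  rewrite ler_wpM2l// -!expRD ler_expR le_eqVlt; apply/orP; left; apply/eqP.
  by rewrite /e; field.
rewrite mul1r in H2; apply: le_trans H2; rewrite ler_expR lerN2.
have -> : (k' - k) ^+ 2 * ell p = ((k' - k) * y) ^+ 2 / 2 by rewrite scale_sqr//; field.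
rewrite ler_wpM2r// ler_sqr ?nnegrE ?mulr_ge0 ?subr_ge0 ?(ltW kk) ?(le_trans ky kr)//.
by rewrite mulrBl lerB.
Unshelve. all: by end_near. Qed.

End single.

Section dense.
Variables (g k : R) (B : nat).
Hypotheses (g0 : 0 < g) (gk : g <= k) (k1 : k < 1).
Hypothesis gB : g <= grid_loss B * Num.sqrt r.
Hypothesis F0 : 0 < 2 * (1 - beta - (k - g) ^+ 2) - (1 - k ^+ 2).

Lemma risk_upper_dense (e0 : R) : 0 < e0 ->
  \forall p \near \oo, (risk_1side p (n p) (rho p) (s p) <= e0%:E)%E.
Proof.
move=> e00; pose F := 2 * (1 - beta - (k - g) ^+ 2) - (1 - k ^+ 2).
have F00 : 0 < F by exact: F0.
(* [e] pays for lower-order terms of [power_bound], and e <= g^2/2 secures [tail_power]. [A] is the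
   exponent of D; [Ah] and [A2] handle D and m in the denominator of D^2/(m + D). *)
pose h := F / 4; pose e := Num.min h (g ^+ 2 / 2).
have h0 : 0 < h by rewrite divr_gt0.
have g2 : 0 < g ^+ 2 / 2 by rewrite divr_gt0// exprn_gt0.
have e1 : 0 < e by rewrite lt_min h0.
have eh : e <= h by rewrite ge_min lexx.
have eg : e <= g ^+ 2 / 2 by rewrite ge_min lexx orbT.
pose A := 1 - beta - (k - g) ^+ 2 - e.
have k0 : 0 < k := lt_le_trans g0 gk.
have k2 : k ^+ 2 <= 1 by rewrite expr_le1 ?ltW.
have F4 : F = 4 * h by rewrite /h; field.
have FE : F = 2 * (A + e) - (1 - k ^+ 2) by rewrite /F /A; ring.
have Ah : h <= A by lra.
have A2 : h + (1 - k ^+ 2) <= 2 * A by lra.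
pose C0 : R := (2 ^ B.+2)%:R * 3.
have C00 : 0 <= C0 by rewrite mulr_ge0.
near=> p.
have p0 : (0 < p)%N by near: p; exact: nbhs_infty_gt.
have s0 : (0 < s p)%N by near: p; exact: s_gt0.
have l0 : 0 <= ell p by near: p; exact: ln_nat_large.
pose y := Num.sqrt (2 * ell p).
have y2 : y ^+ 2 = 2 * ell p by rewrite sqr_sqrtr// mulr_ge0.
(* The 20 gives e log p = e y^2/2 >= 10 y, which covers the terms 4(k-g)y + 6 created by the shift 2
   in [power_bound]. *)
have yl : Num.max 1 (20 / e) ^+ 2 <= 2 * ell p.
  by rewrite -ler_pdivrMl//; near: p; exact: ln_nat_large.
have yM : Num.max 1 (20 / e) <= y.
  by rewrite -ler_sqr ?nnegrE ?sqrtr_ge0 ?le_max ?ler01// y2.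
have y1 : 1 <= y by apply: le_trans yM; rewrite le_max lexx.
have y20 : 20 <= y * e by rewrite -ler_pdivrMr//; apply: le_trans yM; rewrite le_max lexx orbT.
have y0 : 0 <= y := le_trans ler01 y1.
have pw : expR (- (((k - g) ^+ 2 + e) * ell p)) / 2 <= power_bound (k * y) (g * y).
  rewrite /power_bound ler_wpM2r// ler_expR lerN2.
  have w0 : 0 <= (k - g) by rewrite subr_ge0.
  have w1 : (k - g) * y <= 1 * y.
    by rewrite ler_wpM2r// lerBlDr (le_trans (ltW k1))// lerDl ltW.
  have y3 : 20 * y <= y ^+ 2 * e by rewrite expr2 mulrAC ler_wpM2r.
  rewrite (_ : (k * y + 2 - g * y) ^+ 2 / 2 + 2 * (k * y + 2 - g * y) =
     (k - g) ^+ 2 * y ^+ 2 / 2 + 4 * ((k - g) * y) + 6); last by field.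
  rewrite y2 in y3 *; lra.
have l8 : ln 8 / (g ^+ 2 / 2) <= ell p by near: p; exact: ln_nat_large.
have tp : 2 * tail_bound (k * y) <= power_bound (k * y) (g * y).
  apply: le_trans pw; rewrite tail_scale// ler_pdivlMr//.
  rewrite (_ : 2 * _ * 2 = 8 * expR (- (k ^+ 2 * ell p))); last by ring.
  rewrite -[X in X * _](@lnK R) ?posrE// -expRD ler_expR.
  rewrite ler_pdivrMr// in l8.
  have : ell p * (g ^+ 2 / 2) <= (k ^+ 2 - (k - g) ^+ 2 - e) * ell p.
    rewrite mulrC ler_wpM2r//; have := ler_wpM2l (ltW g0) gk.
    rewrite (_ : k ^+ 2 - (k - g) ^+ 2 = 2 * (g * k) - g ^+ 2); last by ring.
    by rewrite -expr2; lra.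
  lra.
have gr : g * y <= grid_loss B * rho p by rewrite rhoE mulrA ler_wpM2r.
have gky : g * y <= k * y by rewrite ler_wpM2r.
have sb : expR ((1 - beta) * ell p) / 2 <= (s p)%:R <= 2 * expR ((1 - beta) * ell p).
  by near: p; exact: (s_bounds hs).
apply: le_trans (risk_count_le p (n p) (mulr_ge0 (ltW k0) y0) gky s0 tp (sqrtr_ge0 _) gr) _.
rewrite lee_fin.
have CE : @count_error R p (k * y) (g * y) (s p) <= expR (- (expR (h * ell p) / 128 ^+ 2)).
  rewrite /count_error ler_expR lerN2.
  set D := _ * (_ / 2); set m := p%:R * _.
  have mE : m = 2 * expR ((1 - k ^+ 2) * ell p).
    rewrite /m tail_scale// mulrCA -[X in _ * (X * _)](expR_ln_nat p0) -expRD.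
    by congr (_ * expR _); ring.
  have DA : expR (A * ell p) / 8 <= D.
    move/andP: sb => [sb _].
    have pos2 : 0 <= 2^-1 :> R by [].
    have E3 x : 0 <= expR x / 2 :> R by rewrite divr_ge0 ?expR_ge0.
    apply: le_trans (ler_pM (E3 _) (mulr_ge0 (E3 _) pos2) sb (ler_wpM2r pos2 pw)).
    rewrite (_ : _ / 2 * _ = expR ((1 - beta) * ell p) *
      expR (- (((k - g) ^+ 2 + e) * ell p)) / 8); last by field.
    rewrite ler_wpM2r// -expRD ler_expR le_eqVlt; apply/orP; left; apply/eqP.
    by rewrite /A; ring.
  have D0 : 0 < D by apply: lt_le_trans DA; rewrite divr_gt0 ?expR_gt0.
  have m0 : 0 < m by rewrite mE mulr_gt0 ?expR_gt0.
  rewrite ler_pdivlMr ?mulr_gt0 ?addr_gt0//.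
  have x0 := expR_gt0 (h * ell p).
  have x1 : expR (h * ell p) <= 8 * D.
    rewrite -ler_pdivrMl// mulrC; apply: le_trans DA; rewrite ler_wpM2r//.
    by rewrite ler_expR ler_wpM2r.
  have x2 : expR (h * ell p) * m <= 128 * D ^+ 2.
    rewrite mE mulrCA -expRD -mulrDl.
    apply: (@le_trans _ _ (128 * (expR (A * ell p) / 8) ^+ 2)); last first.
      by rewrite ler_wpM2l// ler_sqr ?nnegrE ?(ltW D0)// divr_ge0 ?expR_ge0.
    rewrite exprMn -expRM_natl.
    have : expR ((h + (1 - k ^+ 2)) * ell p) <= expR (2 * (A * ell p)).
      by rewrite ler_expR mulrA ler_wpM2r.
    have -> : 8^-1 ^+ 2 = 64^-1 :> R by field.
    lra.
  have x3 : expR (h * ell p) * D <= 8 * D ^+ 2.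
    by rewrite expr2 mulrA ler_wpM2r// ltW.
  have D2 : 0 <= D ^+ 2 by exact: sqr_ge0.
  have h4 (E m' D' X : R) : 0 <= X -> E * m' <= 128 * X -> E * D' <= 8 * X ->
    E / 128 ^+ 2 * (32 * (m' + D')) <= X by lra.
  exact: h4.
have G : (grid_size (n p) B)%:R <= C0 * expR ((a + 1) * ell p).
  by near: p; exact: grid_size_bound.
have fin : (C0 + 1) * expR (- (1 * ell p)) <= e0 by near: p; exact: expR_small.
apply: le_trans fin.
set c := count_error _ _ _ in CE *.
have c0 : 0 <= c by exact: expR_ge0.
have E1 : 1 <= expR ((a + 1) * ell p).
  by rewrite -[leLHS]expR0 ler_expR mulr_ge0// addr_ge0// ltW.
(* The error exp(-p^h/128^2) must beat p^(a+1) grid points with a factor 1/p to spare, whence a +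
   2. *)
have lh : (a + 2) * 2 * 128 ^+ 2 / h ^+ 2 <= ell p by near: p; exact: ln_nat_large.
rewrite ler_pdivrMr ?exprn_gt0// in lh.
have Eh := @expR_ge1Dxn R (h * ell p) 1 (mulr_ge0 (ltW h0) l0).
rewrite (_ : 2`! = 2)%N// in Eh.
have lh2 := ler_wpM2r l0 lh.
rewrite (_ : ell p * h ^+ 2 * ell p = (h * ell p) ^+ 2) in lh2; last by ring.
apply: (@le_trans _ _ ((C0 + 1) * expR ((a + 1) * ell p) * c)).
  rewrite (_ : _ + c = ((grid_size (n p) B)%:R + 1) * c); last by ring.
  by rewrite ler_wpM2r//; lra.
rewrite -mulrA ler_wpM2l ?addr_ge0//.
apply: le_trans (ler_wpM2l (expR_ge0 _) CE) _.
rewrite -expRD ler_expR mul1r lerBlDr -lerBlDl ler_pdivlMr; last by rewrite exprn_gt0.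
have h4 (E l H X : R) : (a + 2) * 2 * X * l <= H -> 1 + H / 2 <= E ->
  ((a + 1) * l - - l) * X <= E by lra.
exact: h4 lh2 Eh.
Unshelve. all: by end_near. Qed.

End dense.
End upper.

(** * Choice of signal and threshold exponents *)

Section upper_exponents.
Context {R : realType}.

Lemma grid_loss_approx (g x : R) : 0 < x -> g < x -> exists B, g <= grid_loss B * x.
Proof.
move=> x0 gx; pose q := x / (x - g); exists (Num.truncn q).+1.
set B := (Num.truncn q).+1.
have d0 : 0 < x - g by rewrite subr_gt0.
have qB : q <= (2 ^ B)%:R.
  apply: (@le_trans _ _ B%:R); first exact: ltW (truncnS_gt q).
  by rewrite ler_nat ltnW// ltn_expl.
have P0 : 0 < (2 ^ B)%:R :> R by rewrite ltr0n expn_gt0.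
rewrite ler_pdivrMr// -ler_pdivrMl// in qB.
by rewrite /grid_loss mulrBl mul1r; lra.
Qed.

Lemma dense_exponents (a beta r : R) : 1 / 2 < beta -> beta < 1 -> 0 < r ->
  r2star a beta < r ->
  exists g k : R, [/\ 0 < g, g <= k, k < 1, g < Num.sqrt r &
    0 < 2 * (1 - beta - (k - g) ^+ 2) - (1 - k ^+ 2)].
Proof.
move=> b2 b1 r0; rewrite /r2star => hr.
have sr0 : 0 < Num.sqrt r by rewrite sqrtr_gt0.
have [b34|b34] := ltP beta (3 / 4).
  rewrite (ltW b34) in hr.
  (* Keeping g^2 < 1/4 makes the optimal threshold k = 2g smaller than 1. *)
  have m1 : beta - 1 / 2 < Num.min r (1 / 4) by rewrite lt_min hr; lra.
  pose t := (beta - 1 / 2 + Num.min r (1 / 4)) / 2.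
  have t1 : beta - 1 / 2 < t by rewrite /t; lra.
  have t2 : t < Num.min r (1 / 4) by rewrite /t; lra.
  have t0 : 0 < t by lra.
  move: t2; rewrite lt_min => /andP[tr t4].
  pose g := Num.sqrt t.
  have g2 : g ^+ 2 = t by rewrite sqr_sqrtr// ltW.
  have g0 : 0 < g by rewrite sqrtr_gt0.
  exists g, (2 * g); split => //; first by lra.
  - have : g < 1 / 2 by rewrite -ltr_sqr ?nnegrE ?(ltW g0)// g2 expr2; lra.
    lra.
  - by rewrite ltr_sqrt.
  - rewrite (_ : _ - _ = 2 * (g ^+ 2 - (beta - 1 / 2))); last by field.
    by rewrite g2; lra.
pose c := Num.sqrt (1 - beta).
have c2 : c ^+ 2 = 1 - beta by rewrite sqr_sqrtr//; lra.
have c0 : 0 < c by rewrite sqrtr_gt0; lra.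
have c12 : c <= 1 / 2 by rewrite -ler_sqr ?nnegrE ?(ltW c0)// c2 !expr2; lra.
have hr' : (1 - c) ^+ 2 < r.
  (* beta = 3/4 lands here although [r2star] uses its first formula; both formulas give 1/4. *)
  move: hr; rewrite b1 -/c; case: (leP beta (3 / 4)) => // b34' hr.
  have b34E : beta = 3 / 4 by apply/eqP; rewrite eq_le b34 b34'.
  have cE : c = 1 / 2.
    by apply/eqP; rewrite -(eqrXn2 (n := 2)) ?(ltW c0)// c2 b34E expr2; apply/eqP; field.
  by move: hr; rewrite cE b34E expr2; lra.
have c1r : 1 - c < Num.sqrt r.
  rewrite -ltr_sqr ?nnegrE ?(ltW sr0) ?subr_ge0//; last by lra.
  by rewrite sqr_sqrtr ?(ltW r0).
have m1 : 1 - c < Num.min (Num.sqrt r) 1 by rewrite lt_min c1r; lra.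
pose g := (1 - c + Num.min (Num.sqrt r) 1) / 2.
have g1 : 1 - c < g by rewrite /g; lra.
have g2 : g < Num.min (Num.sqrt r) 1 by rewrite /g; lra.
move: g2; rewrite lt_min => /andP[gr gl].
have g0 : 0 < g by lra.
pose d := c ^+ 2 - (1 - g) ^+ 2.
have d0 : 0 < d.
  by rewrite subr_gt0 ltr_sqr ?nnegrE ?(ltW c0) ?subr_ge0 ?(ltW gl)//; lra.
(* With 1 - k <= d/2 the null term 1 - k^2 < 2(1-k) costs less than d, out of an available 2d. *)
exists g, (Num.max g (1 - d / 2)).
have k1 : Num.max g (1 - d / 2) < 1 by rewrite gt_max gl; lra.
have gk : g <= Num.max g (1 - d / 2) by rewrite le_max lexx.
have dk : 1 - d / 2 <= Num.max g (1 - d / 2) by rewrite le_max lexx orbT.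
split => //; move: (Num.max _ _) k1 gk dk => k k1 gk dk.
have h1 : (k - g) ^+ 2 <= (1 - g) ^+ 2.
  by rewrite ler_sqr ?nnegrE ?subr_ge0 ?(ltW gl)// lerD2r ltW.
have h2 : 1 - k ^+ 2 < 2 * (1 - k).
  have : 0 < (1 - k) ^+ 2 by rewrite exprn_gt0// subr_gt0.
  by rewrite !expr2; lra.
by rewrite -c2; rewrite /d in dk; lra.
Qed.

Lemma single_upper_exponents (a r : R) : 0 < a -> 1 + a < r ->
  exists k k' : R, [/\ 0 < k, k < k', 1 + a < k ^+ 2 & k' < Num.sqrt r].
Proof.
move=> a0 ar; pose x := Num.sqrt (1 + a); pose z := Num.sqrt r.
have x0 : 0 < x by rewrite sqrtr_gt0; lra.
have xz : x < z by rewrite ltr_sqrt//; lra.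
have x2 : x ^+ 2 = 1 + a by rewrite sqr_sqrtr//; lra.
exists (x + (z - x) / 3), (x + (z - x) * 2 / 3); split; [lra|lra| |by rewrite -/z; lra].
by rewrite -x2 ltr_sqr ?nnegrE ?(ltW x0)//; lra.
Qed.

End upper_exponents.
Unset Implicit Arguments.

Theorem theorem3 (R : realType) (a beta : R) (n s : nat -> nat) :
  0 < a -> 1 / 2 < beta -> beta <= 1 ->
  (fun p : nat => ln (ln (n p)%:R) / (a * ln p%:R)) @ \oo --> (1 : R) ->
  (fun p : nat => (s p)%:R / (p%:R `^ (1 - beta))) @ \oo --> (1 : R) ->
  forall r : R, 0 < r ->
    (r < r2star a beta ->
       ~ ((fun p : nat => risk_1side p (n p) (Num.sqrt (2 * r * ln p%:R)) (s p))
            @ \oo --> 0%E)) /\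
    (r2star a beta < r ->
       (fun p : nat => risk_1side p (n p) (Num.sqrt (2 * r * ln p%:R)) (s p))
         @ \oo --> 0%E).
Proof.
move=> a0 b2 b1 hn hs r r0; have b0 : 0 < beta by lra.
have sr0 : 0 < Num.sqrt r by rewrite sqrtr_gt0.
have [bE|b1'] : beta = 1 \/ beta < 1.
- by case: (ltgtP beta 1) b1 => // ? _; [right|left].
- subst beta; have -> : r2star a 1 = 1 + a.
    by rewrite /r2star ltxx; case: (leP 1 (3 / 4)) => // h; exfalso; lra.
  split => hr.
    have [r' [u [e [rr u0 u1 e0 hexp]]]] := single_exponents a0 r0 hr.
    have [c c0 hc] := risk_lower_single a0 hn hs r0 rr u0 u1 e0 hexp.
    exact: not_cvg_ereal0 c0 hc.
  have [k [k' [k0 kk ka kr]]] := single_upper_exponents a0 hr.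
  have [B hB] := grid_loss_approx sr0 kr.
  apply: cvg_ereal0 => e e0.
  have h1 := risk_ge0 r a0 b0 hn hs.
  have h2 := risk_upper_single a0 hn hs r0 k0 kk ka hB e0.
  by apply: filterS2 h1 h2 => p -> ->.
split => hr.
  have [r' [u [rr u0 u1 hexp]]] := sparse_exponents b2 b1' r0 hr.
  have [c c0 hc] := risk_lower_sparse a0 b0 hn hs r0 rr u0 u1 b1' hexp.
  exact: not_cvg_ereal0 c0 hc.
have [g [k [g0 gk k1 gr F0]]] := dense_exponents b2 b1' r0 hr.
have [B hB] := grid_loss_approx sr0 gr.
apply: cvg_ereal0 => e e0.
have h1 := risk_ge0 r a0 b0 hn hs.
have h2 := risk_upper_dense a0 hn hs r0 g0 gk k1 hB F0 e0.
by apply: filterS2 h1 h2 => p -> ->.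
Qed.
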